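(* Let $A$ be an artinian ring. Then $D^b(A\text{-mod})=\langle A/J(A)\rangle_{\operatorname{ll}(A)}$. In particular, $\dim D^b(A\text{-mod})\le\operatorname{ll}(A)-1$.
   Context: $A\text{-mod}$ is the category of finitely generated left $A$-modules. $J(A)$ is the Jacobson radical of $A$ and the Loewy length $\operatorname{ll}(A)$ is the smallest integer $i$ such that $J(A)^i=0$. For a triangulated category $\mathcal{T}$ and a subcategory (or object) $\mathcal{I}$: $\langle\mathcal{I}\rangle$ is the smallest full subcategory containing $\mathcal{I}$ and closed under finite direct sums, direct summands and shifts; $\mathcal{I}_1*\mathcal{I}_2$ is the full subcategory of objects $M$ for which there is a distinguished triangle $M_1\to M\to M_2\to M_1[1]$ with $M_i\in\mathcal{I}_i$; $\mathcal{I}_1\diamond\mathcal{I}_2=\langle\mathcal{I}_1*\mathcal{I}_2\rangle$; $\langle\mathcal{I}\rangle_0=0$ and $\langle\mathcal{I}\rangle_i=\langle\mathcal{I}\rangle_{i-1}\diamond\langle\mathcal{I}\rangle$ for $i\ge1$. $\dim\mathcal{T}$ is the minimal integer $d\ge0$ such that there is $M\in\mathcal{T}$ with $\mathcal{T}=\langle M\rangle_{d+1}$ (and $\infty$ if there is none). *)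

(* Defs.v *)
From HB Require Import structures.
From mathcomp Require Import all_boot all_order all_algebra.
From mathcomp Require Import boolp classical_sets zify.

Set Implicit Arguments.
Unset Strict Implicit.
Unset Printing Implicit Defensive.

Import GRing.Theory.

Local Open Scope quotient_scope.
Local Open Scope classical_set_scope.
Local Open Scope ring_scope.

Definition is_least (P : nat -> Prop) (n : nat) : Prop :=
  P n /\ forall m, P m -> (n <= m)%N.

(* The data of a triangulated category.  Morphisms are compared with [heq].   *)
(* [shift n] is the functor [n], and [dist] is the class of distinguished     *)
(* triangles X -> Y -> Z -> X[1].  Of the axioms only those of a category     *)
(* with endofunctors [n] are recorded: the definitions below use no other.    *)
Record tricat := Tricat {
  ob :> Type;
  hom : ob -> ob -> Type;
  heq : forall X Y : ob, hom X Y -> hom X Y -> Prop;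
  idm : forall X : ob, hom X X;
  compm : forall X Y Z : ob, hom Y Z -> hom X Y -> hom X Z;
  shift : int -> ob -> ob;
  shiftm : forall (n : int) (X Y : ob), hom X Y -> hom (shift n X) (shift n Y);
  dist : forall X Y Z : ob, hom X Y -> hom Y Z -> hom Z (shift 1 X) -> Prop;
  heq_refl : forall X Y (f : hom X Y), heq f f;
  heq_sym : forall X Y (f g : hom X Y), heq f g -> heq g f;
  heq_trans : forall X Y (f g h : hom X Y), heq f g -> heq g h -> heq f h;
  heq_comp : forall X Y Z (g g' : hom Y Z) (f f' : hom X Y),
    heq g g' -> heq f f' -> heq (compm g f) (compm g' f');
  comp_assoc : forall X Y Z W (h : hom Z W) (g : hom Y Z) (f : hom X Y),
    heq (compm h (compm g f)) (compm (compm h g) f);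
  comp_idl : forall X Y (f : hom X Y), heq (compm (idm Y) f) f;
  comp_idr : forall X Y (f : hom X Y), heq (compm f (idm X)) f;
  shift_heq : forall n X Y (f g : hom X Y),
    heq f g -> heq (shiftm n f) (shiftm n g);
  shift_id : forall n X, heq (shiftm n (idm X)) (idm (shift n X));
  shift_comp : forall n X Y Z (g : hom Y Z) (f : hom X Y),
    heq (shiftm n (compm g f)) (compm (shiftm n g) (shiftm n f))
}.

Arguments idm {t} X.
Arguments shift {t} n X.
Arguments shiftm {t} n {X Y} f.

Section Generation.
Variable T : tricat.
Implicit Types (X Y Z M : T) (I : T -> Prop).

Definition is_zero Z : Prop :=
  (forall X, exists f : hom Z X, forall g : hom Z X, heq g f) /\
  (forall X, exists f : hom X Z, forall g : hom X Z, heq g f).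

(* Z is a direct sum of X and Y.  In an additive category this is the same as *)
(* being a coproduct.                                                         *)
Definition is_sum X Y Z : Prop :=
  exists (i1 : hom X Z) (i2 : hom Y Z), forall W (f : hom X W) (g : hom Y W),
    exists h : hom Z W,
      [/\ heq (compm h i1) f, heq (compm h i2) g &
          forall h' : hom Z W,
            heq (compm h' i1) f -> heq (compm h' i2) g -> heq h' h].

(* Full subcategories are given by their objects. *)

(* The subcategory <I>.  Closure under summands makes it closed under         *)
(* isomorphisms: if X is isomorphic to Z, then Z is a direct sum of X and 0.  *)
Inductive gen I : T -> Prop :=
| gen_base X : I X -> gen I X
| gen_zero Z : is_zero Z -> gen I Z
| gen_sum X Y Z : is_sum X Y Z -> gen I X -> gen I Y -> gen I Z
| gen_summand X Y Z : is_sum X Y Z -> gen I Z -> gen I X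
| gen_shift n X : gen I X -> gen I (shift n X).

Definition star (I1 I2 : T -> Prop) : T -> Prop := fun M =>
  exists M1 M2 (f : hom M1 M) (g : hom M M2) (h : hom M2 (shift 1 M1)),
    [/\ I1 M1, I2 M2 & dist f g h].

Definition diamond (I1 I2 : T -> Prop) : T -> Prop := gen (star I1 I2).

Fixpoint geni I (i : nat) : T -> Prop :=
  if i is i'.+1 then diamond (geni I i') (gen I) else is_zero.

Definition only M : T -> Prop := fun X => X = M.

(* dim T = d; the dimension is infinite when no d satisfies this. *)
Definition is_dim : nat -> Prop :=
  is_least (fun d => exists M, forall X, geni (only M) d.+1 X).

End Generation.

Section Rings.
Variable A : pzRingType.

Definition left_ideal (I : set A) : Prop :=
  [/\ I 0, forall x y, I x -> I y -> I (x + y) &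
      forall a x, I x -> I (a * x)].

(* Only the left-hand chain condition: an artinian ring on both sides is in   *)
(* particular left artinian.                                                  *)
Definition left_artinian : Prop :=
  forall I : nat -> set A, (forall n, left_ideal (I n)) ->
    (forall n, I n.+1 `<=` I n) ->
    exists N, forall n, (N <= n)%N -> I n = I N.

Definition maximal_left_ideal (M : set A) : Prop :=
  [/\ left_ideal M, M <> setT &
      forall I, left_ideal I -> M `<=` I -> I <> setT -> I = M].

Definition jacobson : set A :=
  [set x | forall M, maximal_left_ideal M -> M x].

Fixpoint jacobson_pow (i : nat) : set A :=
  if i is i'.+1 then
    [set x | exists k (u v : 'I_k -> A),
       [/\ forall l, jacobson (u l), forall l, jacobson_pow i' (v l) &
           x = \sum_(l < k) u l * v l]]
  else setT.

Definition is_loewy_length : nat -> Prop :=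
  is_least (fun i => jacobson_pow i = [set 0]).

Lemma jacobson_left_ideal : left_ideal jacobson.
Proof.
split=> [M [[]] //|x y Jx Jy M mM|a x Jx M mM]; case: (mM) => -[_ MD MM] _ _.
  by apply: MD; [apply: Jx|apply: Jy].
by apply: MM; apply: Jx.
Qed.

Definition jacobson_pred : {pred A} := fun x => `[< jacobson x >].

Fact jacobson_zmod_closed : zmod_closed jacobson_pred.
Proof.
have [J0 JD JM] := jacobson_left_ideal.
split=> [|x y]; rewrite !unfold_in; first exact/asboolP.
move=> /asboolP Jx /asboolP Jy; apply/asboolP; apply: JD => //.
by rewrite -mulN1r; apply: JM.
Qed.
HB.instance Definition _ :=
  GRing.isZmodClosed.Build A jacobson_pred jacobson_zmod_closed.

Definition quoJ : Type := @Quotient.quot A jacobson_pred.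

HB.instance Definition _ := GRing.Zmodule.on quoJ.
HB.instance Definition _ := EqQuotient.on quoJ.

Definition quoJ_pi (x : A) : quoJ := \pi_quoJ x.

Lemma quoJ_pi_repr q : quoJ_pi (repr q) = q. Proof. exact: reprK. Qed.

Lemma quoJ_piP x y : quoJ_pi x = quoJ_pi y <-> jacobson (x - y).
Proof.
have := @Quotient.idealrBE A jacobson_pred x y.
rewrite unfold_in => E; split=> [xy|Jxy].
  by apply/asboolP; rewrite [X in is_true X]E; apply/eqP.
by apply/eqP; have := asboolT Jxy; rewrite [X in is_true X -> _]E.
Qed.

Lemma quoJ_piD x y : quoJ_pi (x + y) = quoJ_pi x + quoJ_pi y.
Proof. exact: (@Quotient.pi_add A jacobson_pred x y). Qed.

Definition quoJ_scale (a : A) (q : quoJ) : quoJ := quoJ_pi (a * repr q).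

Lemma quoJ_scale_pi a x : quoJ_scale a (quoJ_pi x) = quoJ_pi (a * x).
Proof.
have [_ _ JM] := jacobson_left_ideal.
by apply/quoJ_piP; rewrite -mulrBr; apply: JM; apply/quoJ_piP/quoJ_pi_repr.
Qed.

Fact quoJ_scaleA a b q :
  quoJ_scale a (quoJ_scale b q) = quoJ_scale (a * b) q.
Proof.
by rewrite -(quoJ_pi_repr q) (quoJ_scale_pi b) !quoJ_scale_pi mulrA.
Qed.

Fact quoJ_scale1 : left_id 1 quoJ_scale.
Proof. by move=> q; rewrite -(quoJ_pi_repr q) quoJ_scale_pi mul1r. Qed.

Fact quoJ_scaleDr : right_distributive quoJ_scale +%R.
Proof.
move=> a p q; rewrite -(quoJ_pi_repr p) -(quoJ_pi_repr q) -quoJ_piD.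
by rewrite !quoJ_scale_pi mulrDr quoJ_piD.
Qed.

Fact quoJ_scaleDl q : {morph quoJ_scale^~ q : a b / a + b}.
Proof.
move=> a b; rewrite -(quoJ_pi_repr q) !quoJ_scale_pi.
by rewrite mulrDl quoJ_piD.
Qed.

HB.instance Definition _ := GRing.Zmodule_isLmodule.Build A quoJ
  quoJ_scaleA quoJ_scale1 quoJ_scaleDr quoJ_scaleDl.

Definition fg_module (V : lmodType A) : Prop :=
  exists n (g : 'I_n -> V), forall v, exists c : 'I_n -> A,
    v = \sum_(l < n) c l *: g l.

Lemma fg_quoJ : fg_module quoJ.
Proof.
exists 1%N, (fun=> quoJ_pi 1) => q; exists (fun=> repr q).
by rewrite big_ord1 [RHS]quoJ_scale_pi mulr1 quoJ_pi_repr.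
Qed.

Lemma fg_prod (V W : lmodType A) :
  fg_module V -> fg_module W -> fg_module (V * W)%type.
Proof.
move=> [m [g gP]] [n [h hP]].
exists (m + n)%N, (fun l => match split l with
  | inl k => (g k, 0) | inr k => (0, h k) end) => -[v w].
have [c ->] := gP v; have [d ->] := hP w.
exists (fun l => match split l with inl k => c k | inr k => d k end).
rewrite big_split_ord /=.
rewrite (eq_bigr (fun l => (c l *: g l, 0))) => [|l _]; last first.
  by rewrite (unsplitK (inl l)); congr (_, _); rewrite scaler0.
rewrite [X in _ + X](eq_bigr (fun l => (0, d l *: h l))) => [|l _]; last first.
  by rewrite (unsplitK (inr l)); congr (_, _); rewrite scaler0.
have fE (I : finType) (F : I -> V) :
    \sum_l (F l, 0 : W) = (\sum_l F l, 0).
  by elim/big_rec2: _ => // l y1 y2 _ ->; congr (_, _); rewrite /= addr0.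
have sE (I : finType) (F : I -> W) :
    \sum_l (0 : V, F l) = (0, \sum_l F l).
  by elim/big_rec2: _ => // l y1 y2 _ ->; congr (_, _); rewrite /= addr0.
by rewrite fE sE; congr (_, _); rewrite /= ?addr0 ?add0r.
Qed.

End Rings.

#[local] Obligation Tactic := idtac.

Section Complexes.
Variable A : pzRingType.

(* The differential X^i -> X^(i+1) is indexed by i, j and a proof of          *)
(* i + 1 = j; this avoids transports in shifted indices.                      *)
Record bcomplex := BComplex {
  term :> int -> lmodType A;
  diff : forall i j : int, i + 1 = j -> {linear term i -> term j};
  diffK : forall (i j k : int) (e : i + 1 = j) (e' : j + 1 = k) (x : term i),
    diff e' (diff e x) = 0;
  term_fg : forall i, fg_module (term i);
  term_bounded : exists N : nat, forall i : int, (N < `|i|)%N ->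
    forall x : term i, x = 0
}.

Record chain_map (X Y : bcomplex) := ChainMap {
  cmap :> forall i : int, {linear X i -> Y i};
  cmapE : forall (i j : int) (e : i + 1 = j) (x : X i),
    cmap j (diff X e x) = diff Y e (cmap i x)
}.

Definition chain_id (X : bcomplex) : chain_map X X :=
  @ChainMap X X (fun i => idfun) (fun _ _ _ _ => erefl).

Program Definition chain_comp (X Y Z : bcomplex) (g : chain_map Y Z)
    (f : chain_map X Y) : chain_map X Z :=
  @ChainMap X Z (fun i => g i \o f i) _.
Next Obligation. by move=> X Y Z g f i j e x /=; rewrite !cmapE. Qed.

(* f induces an injection, resp. a surjection, on the cohomology              *)
(* ker (X^j -> X^k) / im (X^i -> X^j) in every degree j.                      *)
Definition quasi_iso (X Y : bcomplex) (f : chain_map X Y) : Prop :=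
  forall (i j k : int) (e : i + 1 = j) (e' : j + 1 = k),
    (forall x : X j, diff X e' x = 0 ->
       (exists y : Y i, f j x = diff Y e y) -> exists z : X i, x = diff X e z) /\
    (forall y : Y j, diff Y e' y = 0 ->
       exists2 x : X j, diff X e' x = 0 & exists z : Y i, y = f j x + diff Y e z).

(* X[n]^i = X^(i+n), with differential (-1)^n d *)
Section Shift.
Variables (n : int) (X : bcomplex).

Lemma shift_idx (i j : int) : i + 1 = j -> (i + n) + 1 = j + n.
Proof. by move=> <-; rewrite addrAC. Qed.

Definition shift_diff (i j : int) (e : i + 1 = j) (x : X (i + n)) : X (j + n) :=
  if odd `|n|%N then - diff X (shift_idx e) x else diff X (shift_idx e) x.

Fact shift_diff_linear i j e : linear (@shift_diff i j e).
Proof.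
move=> a u v; rewrite /shift_diff; case: odd; rewrite linearP //.
by rewrite opprD scalerN.
Qed.
HB.instance Definition _ i j e :=
  GRing.isLinear.Build A _ _ *:%R (@shift_diff i j e) (shift_diff_linear e).

Program Definition shift_complex : bcomplex :=
  @BComplex (fun i => X (i + n)) (fun i j e => @shift_diff i j e) _ _ _.
Next Obligation.
move=> i j k e e' x /=; rewrite /shift_diff.
case: odd; last exact: diffK.
by rewrite (linearN (diff X (shift_idx e'))) opprK diffK.
Qed.
Next Obligation. by move=> i; exact: term_fg. Qed.
Next Obligation.
have [N XN] := term_bounded X; exists (N + `|n|)%N => i iN x.
by apply: XN; lia.
Qed.

End Shift.

Program Definition shift_chain (n : int) (X Y : bcomplex) (f : chain_map X Y) :
    chain_map (shift_complex n X) (shift_complex n Y) :=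
  @ChainMap (shift_complex n X) (shift_complex n Y) (fun i => f (i + n)) _.
Next Obligation.
move=> n X Y f i j e x /=; rewrite /shift_diff.
case: odd; last exact: cmapE.
by rewrite (linearN (f (j + n))) cmapE.
Qed.

Lemma shift_quasi_iso n X Y (f : chain_map X Y) :
  quasi_iso f -> quasi_iso (shift_chain n f).
Proof.
move=> fq i j k e e'; have [fi fs] := fq _ _ _ (shift_idx n e) (shift_idx n e').
rewrite /= /shift_diff; case: odd => //; split.
- move=> x /eqP; rewrite oppr_eq0 => /eqP dx0 [y fxE].
  have [|z ->] := fi x dx0; first by exists (- y); rewrite linearN.
  by exists (- z); rewrite linearN opprK.
- move=> y /eqP; rewrite oppr_eq0 => /eqP dy0; have [x dx0 [z ->]] := fs y dy0.
  exists x; first by rewrite dx0 oppr0.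
  by exists (- z); rewrite linearN opprK.
Qed.

(* C(u)^i = X^(i+1) (+) Y^i, with differential (x, y) |-> (- dx, u x + dy) *)
Section Cone.
Variables (X Y : bcomplex) (u : chain_map X Y).

Definition term_cast (i j : int) (e : i = j) : Y i -> Y j :=
  match e with erefl => id end.

Definition cone_diff (i j : int) (e : i + 1 = j) (p : X (i + 1) * Y i) :
    X (j + 1) * Y j :=
  (- diff X (shift_idx 1 e) p.1, term_cast e (u (i + 1) p.1) + diff Y e p.2).

Fact cone_diff_linear i j e : linear (@cone_diff i j e).
Proof.
move=> a [x y] [x' y']; rewrite /cone_diff /=; congr (_, _).
  by rewrite linearP opprD -scalerN.
have -> : term_cast e (u (i + 1) (a *: x + x')) =
    a *: term_cast e (u (i + 1) x) + term_cast e (u (i + 1) x').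
  by case: j / e; rewrite /= linearP.
by rewrite linearP addrACA -scalerDr.
Qed.
HB.instance Definition _ i j e :=
  GRing.isLinear.Build A _ _ *:%R (@cone_diff i j e) (cone_diff_linear e).

Program Definition cone : bcomplex :=
  @BComplex (fun i => (X (i + 1)%R * Y i)%type : lmodType A)
    (fun i j e => @cone_diff i j e) _ _ _.
Next Obligation.
move=> i j k e e' [x y]; rewrite /= /cone_diff /=.
rewrite (linearN (diff X (shift_idx 1 e'))) diffK !oppr0; congr (_, _).
rewrite linearD diffK addr0; case: k / e' => /=; case: j / e => /=.
rewrite linearN cmapE (eq_irrelevance (shift_idx 1 erefl) erefl).
by rewrite addNr.
Qed.
Next Obligation. by move=> i; apply: fg_prod; exact: term_fg. Qed.
Next Obligation.
have [M XM] := term_bounded X; have [N YN] := term_bounded Y.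
exists (M + N + 1)%N => i iMN [x y].
by rewrite (XM _ _ x) ?(YN _ _ y) //; lia.
Qed.

Definition cone_in_map (i : int) (y : Y i) : cone i := (0, y).

Fact cone_in_linear i : linear (@cone_in_map i).
Proof. by move=> a y y'; congr (_, _); rewrite /= scaler0 addr0. Qed.
HB.instance Definition _ i :=
  GRing.isLinear.Build A _ _ *:%R (@cone_in_map i) (cone_in_linear (i := i)).

Program Definition cone_in : chain_map Y cone :=
  @ChainMap Y cone (fun i => @cone_in_map i) _.
Next Obligation.
move=> i j e y; rewrite /= /cone_diff /cone_in_map /=.
congr (_, _); first by rewrite linear0 oppr0.
by case: j / e => /=; rewrite linear0 add0r.
Qed.

Definition cone_out_map (i : int) (p : cone i) : shift_complex 1 X i := p.1.

Fact cone_out_linear i : linear (@cone_out_map i).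
Proof. by []. Qed.
HB.instance Definition _ i :=
  GRing.isLinear.Build A _ _ *:%R (@cone_out_map i) (cone_out_linear (i := i)).

Program Definition cone_out : chain_map cone (shift_complex 1 X) :=
  @ChainMap cone (shift_complex 1 X) (fun i => @cone_out_map i) _.
Next Obligation. by []. Qed.

End Cone.

Section Stalk.
Variables (V : lmodType A) (Vfg : fg_module V).

Definition stalk_term (i : int) : lmodType A :=
  if i == 0 then V else 'M[A]_(0, 0).

Program Definition stalk : bcomplex :=
  @BComplex stalk_term (fun i j _ => \0) _ _ _.
Next Obligation. by []. Qed.
Next Obligation.
move=> i; rewrite /stalk_term; case: ifP => // _.
exists 0%N, (fun=> 0) => v; exists (fun=> 0).
by rewrite big_ord0; apply/matrixP => -[].
Qed.
Next Obligation.
exists 0%N => i i0; rewrite /stalk_term; case: eqP => [E|_ x].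
  by rewrite E in i0.
by apply/matrixP => -[].
Qed.

End Stalk.

(* The bounded derived category: the localization of the category of bounded  *)
(* complexes at the quasi-isomorphisms.  Homotopic maps need not be           *)
(* identified beforehand: they become equal in the localization.              *)

(* A morphism is a formal composite of chain maps and of formal inverses of   *)
(* quasi-isomorphisms, up to the congruence [deq].                            *)
Inductive dhom : bcomplex -> bcomplex -> Type :=
| dmap X Y : chain_map X Y -> dhom X Y
| dinv X Y (s : chain_map X Y) : quasi_iso s -> dhom Y X
| dcomp X Y Z : dhom Y Z -> dhom X Y -> dhom X Z.

Inductive deq : forall X Y, dhom X Y -> dhom X Y -> Prop :=
| deq_refl X Y (f : dhom X Y) : deq f f
| deq_sym X Y (f g : dhom X Y) : deq f g -> deq g f
| deq_trans X Y (f g h : dhom X Y) : deq f g -> deq g h -> deq f h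
| deq_comp X Y Z (g g' : dhom Y Z) (f f' : dhom X Y) :
    deq g g' -> deq f f' -> deq (dcomp g f) (dcomp g' f')
| deq_assoc X Y Z W (h : dhom Z W) (g : dhom Y Z) (f : dhom X Y) :
    deq (dcomp h (dcomp g f)) (dcomp (dcomp h g) f)
| deq_idl X Y (f : dhom X Y) : deq (dcomp (dmap (chain_id Y)) f) f
| deq_idr X Y (f : dhom X Y) : deq (dcomp f (dmap (chain_id X))) f
| deq_ext X Y (f g : chain_map X Y) :
    (forall i (x : X i), f i x = g i x) -> deq (dmap f) (dmap g)
| deq_map_comp X Y Z (g : chain_map Y Z) (f : chain_map X Y) :
    deq (dmap (chain_comp g f)) (dcomp (dmap g) (dmap f))
| deq_invl X Y (s : chain_map X Y) (sq : quasi_iso s) :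
    deq (dcomp (dinv sq) (dmap s)) (dmap (chain_id X))
| deq_invr X Y (s : chain_map X Y) (sq : quasi_iso s) :
    deq (dcomp (dmap s) (dinv sq)) (dmap (chain_id Y)).

Fixpoint dshift (n : int) (X Y : bcomplex) (f : dhom X Y) :
    dhom (shift_complex n X) (shift_complex n Y) :=
  match f with
  | dmap _ _ g => dmap (shift_chain n g)
  | dinv _ _ _ sq => dinv (shift_quasi_iso n sq)
  | dcomp _ _ _ g h => dcomp (dshift n g) (dshift n h)
  end.

Lemma dshift_id n X :
  deq (dshift n (dmap (chain_id X))) (dmap (chain_id (shift_complex n X))).
Proof. exact: deq_ext. Qed.

Lemma dshift_deq n X Y (f g : dhom X Y) :
  deq f g -> deq (dshift n f) (dshift n g).
Proof.
elim=> {X Y f g} /=.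
- by move=> *; apply: deq_refl.
- by move=> *; apply: deq_sym.
- by move=> X Y f g h _ fg _ gh; apply: deq_trans gh.
- by move=> *; apply: deq_comp.
- by move=> *; apply: deq_assoc.
- move=> X Y f; apply: deq_trans (deq_idl _); apply: deq_comp (deq_refl _).
  exact: dshift_id.
- move=> X Y f; apply: deq_trans (deq_idr _); apply: deq_comp (deq_refl _) _.
  exact: dshift_id.
- by move=> X Y f g fg; apply: deq_ext => i x; apply: fg.
- move=> X Y Z g f; apply: deq_trans (deq_map_comp _ _).
  exact: deq_ext.
- by move=> X Y s sq; apply: deq_trans (deq_invl _) _; apply: deq_ext.
- by move=> X Y s sq; apply: deq_trans (deq_invr _) _; apply: deq_ext.
Qed.

Definition diso X Y (f : dhom X Y) : Prop :=
  exists g : dhom Y X,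
    deq (dcomp g f) (dmap (chain_id X)) /\ deq (dcomp f g) (dmap (chain_id Y)).

(* The triangles isomorphic to P -u-> Q -> C(u) -> P[1], for u a chain map *)
Definition ddist X Y Z (f : dhom X Y) (g : dhom Y Z)
    (h : dhom Z (shift_complex 1 X)) : Prop :=
  exists (P Q : bcomplex) (u : chain_map P Q)
    (a : dhom X P) (b : dhom Y Q) (c : dhom Z (cone u)),
    [/\ diso a, diso b & diso c] /\
    [/\ deq (dcomp b f) (dcomp (dmap u) a),
        deq (dcomp c g) (dcomp (dmap (cone_in u)) b) &
        deq (dcomp (dshift 1 a) h) (dcomp (dmap (cone_out u)) c)].

Definition Db : tricat :=
  @Tricat bcomplex dhom deq (fun X => dmap (chain_id X)) dcomp
    shift_complex dshift ddist deq_refl deq_sym deq_trans deq_comp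
    deq_assoc deq_idl deq_idr dshift_deq dshift_id
    (fun _ _ _ _ _ _ => deq_refl _).

Definition quoJ_Db : Db := stalk (@fg_quoJ A).

End Complexes.

(* Main.v *)
Require Import Defs.
From HB Require Import structures.
From Stdlib Require Import Setoid Morphisms.
From mathcomp Require Import all_boot all_algebra.
From mathcomp Require Import boolp classical_sets zify.

Set Implicit Arguments.
Unset Strict Implicit.
Unset Printing Implicit Defensive.

Import GRing.Theory.

Local Open Scope quotient_scope.
Local Open Scope classical_set_scope.
Local Open Scope ring_scope.

#[local] Obligation Tactic := idtac.

(** A bounded complex X of finitely generated A-modules has the finite
    filtration by the subcomplexes J^i X, where J is the Jacobson radical.  Each
    successive quotient is a complex of modules killed by J.  Such a complex
    lies in <A/J>, so X is built from A/J in as many steps as the filtration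
    has, that is, in ll(A) steps.

    Three facts about a left artinian ring carry the argument.  First, J is
    nilpotent ([jacobson_nilpotent]), so that ll(A) exists.  Second, J is
    finitely generated as a left ideal ([jacobson_fg]), so that the J^i X are
    again complexes of finitely generated modules.  Third, modules killed by J
    are semisimple: every submodule has a complement ([relative_complement]).
    The last one rests on [jacobson_idempotent], which derives idempotent
    generators modulo J of left ideals from the descending chain condition.

    On the derived side, a complex S of modules killed by J is quasi-isomorphic
    to its cohomology ([gen_semisimple]): in each degree, a complement of the
    boundaries within the cycles gives a subcomplex with zero differential.  A
    complex with zero differential is split into cyclic modules placed in single
    degrees ([gen_zero_diff]), and a cyclic module killed by J is a direct
    summand of A/J ([gen_cyclic]).  The sums used here are sums of complexes;
    that these are coproducts in the derived category, whose morphisms are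
    formal composites of chain maps and inverses of quasi-isomorphisms, is
    [is_sum_dsum].

    The induction on the length ([geni_killed]) uses the distinguished triangle
    JX -> X -> X/JX -> JX[1] ([star_subcx_quotcx]): the powers of J that kill JX
    are one step behind those that kill X. *)

(** * Submodules *)

Section Submodules.
Variable A : pzRingType.
Implicit Type V : lmodType A.

Definition submod V (W : set V) : Prop :=
  [/\ W 0, forall x y, W x -> W y -> W (x + y) & forall a x, W x -> W (a *: x)].

Definition cyclic_sub V (x : V) : set V := [set y | exists a : A, y = a *: x].

Definition sum_sub V (U W : set V) : set V :=
  [set y | exists u w, [/\ U u, W w & y = u + w]].

Lemma submodN V (W : set V) x : submod W -> W x -> W (- x).
Proof. by move=> [_ _ WZ] Wx; rewrite -scaleN1r; apply: WZ. Qed.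

Lemma submodB V (W : set V) x y : submod W -> W x -> W y -> W (x - y).
Proof.
by move=> sW Wx Wy; case: (sW) => _ WD _; apply: WD => //; apply: submodN.
Qed.

Lemma submod_sum V (W : set V) n (f : 'I_n -> V) :
  submod W -> (forall l, W (f l)) -> W (\sum_(l < n) f l).
Proof. by move=> [W0 WD _] Wf; elim/big_ind: _ => // x y; apply: WD. Qed.

Lemma submod_set0 V : submod [set (0 : V)].
Proof.
by split=> // [x y -> ->|a x ->]; rewrite /= ?addr0 ?scaler0.
Qed.

Lemma submod_setI V (U W : set V) : submod U -> submod W -> submod (U `&` W).
Proof.
move=> [U0 UD UZ] [W0 WD WZ]; split=> // [x y [Ux Wx] [Uy Wy]|a x [Ux Wx]].
  by split; [apply: UD|apply: WD].
by split; [apply: UZ|apply: WZ].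
Qed.

Lemma submod_cyclic V (x : V) : submod (cyclic_sub x).
Proof.
split=> [|_ _ [a ->] [b ->]|a _ [b ->]]; first by exists 0; rewrite scale0r.
  by exists (a + b); rewrite scalerDl.
by exists (a * b); rewrite scalerA.
Qed.

Lemma cyclic_sub_gen V (x : V) : cyclic_sub x x.
Proof. by exists 1; rewrite scale1r. Qed.

Lemma cyclic_subS V (W : set V) x : submod W -> W x -> cyclic_sub x `<=` W.
Proof. by move=> [_ _ WZ] Wx _ [a ->]; apply: WZ. Qed.

Lemma submod_sum_sub V (U W : set V) : submod U -> submod W ->
  submod (sum_sub U W).
Proof.
move=> [U0 UD UZ] [W0 WD WZ]; split.
- by exists 0, 0; rewrite addr0.
- move=> _ _ [u [w [Uu Ww ->]]] [u' [w' [Uu' Ww' ->]]].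
  by exists (u + u'), (w + w'); split; [apply: UD|apply: WD|rewrite addrACA].
- move=> a _ [u [w [Uu Ww ->]]].
  by exists (a *: u), (a *: w); split; [apply: UZ|apply: WZ|rewrite scalerDr].
Qed.

Lemma sum_subl V (U W : set V) : submod W -> U `<=` sum_sub U W.
Proof. by move=> [W0 _ _] u Uu; exists u, 0; rewrite addr0. Qed.

Lemma sum_subr V (U W : set V) : submod U -> W `<=` sum_sub U W.
Proof. by move=> [U0 _ _] w Ww; exists 0, w; rewrite add0r. Qed.

(** The union of a chain of submodules is a submodule, so Zorn applies to the
    submodules above a given one that avoid a given set. *)
Lemma maximal_disjoint_submod V (U P : set V) :
  submod U -> U `&` P = set0 ->
  exists K, [/\ submod K, U `<=` K, K `&` P = set0 &
    forall K', submod K' -> K `<=` K' -> K' `&` P = set0 -> K' = K].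
Proof.
move=> sU UP.
(* Without 0 in K, the condition also holds for the union of the empty chain. *)
pose Q (K : set V) := [/\ forall x y, K x -> K y \/ U y -> K (x + y),
  forall a x, K x -> K (a *: x) & K `&` P = set0].
case: (sU) => U0 UD UZ.
have [F FQ Ftot|K [[KD KZ KP] Kmax]] := @Zorn_bigcup V Q.
  split=> [x y [K FK Kx] [[L FL Ly]|Uy]|a x [K FK Kx]|].
  - have [/(_ _ Kx) Lx|/(_ _ Ly) Ky] := Ftot _ _ FK FL.
      by have [LD _ _] := FQ _ FL; exists L => //; apply: LD => //; left.
    by have [KD _ _] := FQ _ FK; exists K => //; apply: KD => //; left.
  - by have [KD _ _] := FQ _ FK; exists K => //; apply: KD => //; right.
  - by have [_ KZ _] := FQ _ FK; exists K => //; apply: KZ.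
  - apply/seteqP; split=> // x [[K FK Kx] Px].
    by have [_ _ <-] := FQ _ FK; split.
have [K0|/eqP/set0P[x Kx]] := pselect (K = set0); last first.
  have K0 : K 0 by rewrite -(scale0r x); apply: KZ.
  exists K; split=> // [|u Uu|K' [_ K'D K'Z] KK' K'P].
  - by split=> // y z Ky Kz; apply: KD => //; left.
  - by rewrite -[u]add0r; apply: KD => //; right.
  apply: contrapT => nK; apply: (Kmax K').
    by rewrite properEneq; split=> //; apply/eqP=> KE; apply: nK.
  split=> // y z K'y [|Uz]; first exact: K'D.
  by apply: K'D => //; apply: KK'; rewrite -[z]add0r; apply: KD => //; right.
case: (Kmax U); last by split=> // x y Ux [|]; apply: UD.
by rewrite K0; split=> // /(_ _ U0).
Qed.

End Submodules.

(** * The Jacobson radical of a left artinian ring *)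

Section Radical.
Variable A : pzRingType.
Local Notation J := (@jacobson A).

Lemma maximal_left_ideal_ex (I : set A) : left_ideal I -> ~ I 1 ->
  exists2 M, maximal_left_ideal M & I `<=` M.
Proof.
move=> lI I1.
have [|K [lK IK K1 Kmax]] := @maximal_disjoint_submod A A^o I [set 1] lI.
  by apply/seteqP; split=> // x [Ix x1]; apply: I1; rewrite -x1.
exists K => //; split=> // [KT|L lL KL LT].
  by have : (K `&` [set (1 : A)]) 1; [rewrite KT | rewrite K1].
apply: Kmax => //; apply/seteqP; split=> // x [Lx x1]; apply: LT.
rewrite /= in x1; rewrite x1 in Lx.
by apply/seteqP; split=> // y _; case: lL => _ _ /(_ y _ Lx); rewrite mulr1.
Qed.

Lemma maximal_left_idealPn (M : set A) x : maximal_left_ideal M -> ~ M x ->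
  exists a m, M m /\ 1 = m + a * x.
Proof.
move=> [lM MT Mmax] Mx; apply: contrapT => nex.
have sx := @submod_cyclic A A^o x.
have /Mmax MxE : left_ideal (sum_sub (V := A^o) M (cyclic_sub (V := A^o) x)).
  exact: submod_sum_sub.
apply: Mx; rewrite -MxE.
- exact/(sum_subr (V := A^o))/(cyclic_sub_gen (V := A^o)).
- exact: (sum_subl (V := A^o)) sx.
- move=> E; apply: nex; have : [set: A] 1 by [].
  by rewrite -E => -[m [_ [Mm [a ->] ->]]]; exists a, m.
Qed.

(** 1 - x has a left inverse: the left ideal it generates lies in no maximal
    one, since x lies in all of them. *)
Lemma jacobson_fixed x z : J x -> x * z = z -> z = 0.
Proof.
move=> Jx xz.
have sx := @submod_cyclic A A^o (1 - x).
have [[b bE]|n1] := pselect (cyclic_sub (V := A^o) (1 - x) 1).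
  by rewrite -[z]mul1r [1]bE -mulrA mulrBl mul1r xz subrr mulr0.
have [M mM sM] := maximal_left_ideal_ex sx n1.
have M1x : M (1 - x) by apply/sM/(cyclic_sub_gen (V := A^o)).
have Mx := Jx M mM; case: mM => -[_ MD MZ] MT _; case: MT.
apply/seteqP; split=> // y _.
by have := MZ y _ (MD _ _ M1x Mx); rewrite subrK mulr1.
Qed.

(** For M maximal and c outside M, the set of y with y c in M is again a maximal
    left ideal; so it contains x. *)
Lemma jacobson_mulr x c : J x -> J (x * c).
Proof.
move=> Jx M mM; have [Mc|Mc] := pselect (M c).
  by case: mM => -[_ _ MZ] _ _; apply: MZ.
pose N := [set y | M (y * c)]; case: (mM) => -[M0 MD MZ] MT Mmax.
have lN : left_ideal N.
  split=> [|y z Ny Nz|a y Ny]; rewrite /N /= ?mul0r //.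
    by rewrite mulrDl; apply: MD.
  by rewrite -mulrA; apply: MZ.
suff /Jx : maximal_left_ideal N by [].
split=> // [NT|I lI NI IT].
  by apply: Mc; have : N 1; [rewrite NT | rewrite /N /= mul1r].
apply/seteqP; split=> // y Iy; apply: contrapT => Ny; apply: IT.
have [a [m [Mm amE]]] := maximal_left_idealPn mM Ny.
have N1 : N (1 - c * a * y).
  rewrite /N /= mulrBl mul1r -!mulrA.
  rewrite (_ : c - c * (a * (y * c)) = c * m); first exact: MZ.
  by rewrite -[X in X - _]mulr1 amE mulrDr addrK.
case: lI => _ ID IZ; apply/seteqP; split=> // z _.
have := ID _ _ (NI _ N1) (IZ (c * a) _ Iy); rewrite subrK => /(IZ z).
by rewrite mulr1.
Qed.

Hypothesis hA : left_artinian A.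

Lemma minimal_left_ideal_ex (P : set A -> Prop) I0 : left_ideal I0 -> P I0 ->
  exists I, [/\ left_ideal I, P I &
    forall K, left_ideal K -> P K -> K `<=` I -> K = I].
Proof.
move=> lI0 PI0; apply: contrapT => nmin.
have /choice[f fP] : forall I, exists I', left_ideal I /\ P I ->
    [/\ left_ideal I', P I', I' `<=` I & I' <> I].
  move=> I; have [[lI PI]|] := pselect (left_ideal I /\ P I); last by exists I.
  apply: contrapT => nI; apply: nmin; exists I; split=> // K lK PK KI.
  by apply: contrapT => nK; apply: nI; exists K.
have itP n : left_ideal (iter n f I0) /\ P (iter n f I0).
  by elim: n => // n /fP[].
have [|n|N NE] := hA (I := fun n => iter n f I0).
- by move=> n; case: (itP n).
- by case: (fP _ (itP n)).
by have [_ _ _ []] := fP _ (itP N); have := NE N.+1 (leqnSn N).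
Qed.

(** A left ideal of A is generated modulo J by an idempotent modulo J, which is
    the semisimplicity of A/J.  If K is minimal with K + I = A then the
    intersection of K and I lies in every maximal M: otherwise the intersection
    of K and M would be a smaller choice of K. *)
Lemma jacobson_idempotent (I : set A) : left_ideal I ->
  exists2 e, I e & forall x, I x -> J (x - x * e).
Proof.
move=> lI.
have lT : left_ideal [set: A] by [].
have [|K [lK [k [i [Kk Ii kiE]]] Kmin]] := @minimal_left_ideal_ex
    (fun K => sum_sub (V := A^o) K I 1) _ lT.
  by exists 1, 0; rewrite addr0; split=> //; case: lI.
exists i => // x Ix.
have xkE : x - x * i = x * k.
  by rewrite -[X in X - _]mulr1 kiE mulrDr addrK.
have Kxk : K (x - x * i) by rewrite xkE; case: lK => _ _ KZ; apply: KZ.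
have Ixk : I (x - x * i).
  by case: (lI) => _ ID IZ; apply: (submodB (V := A^o)) => //; apply: IZ.
move: (x - x * i) Kxk Ixk => y Ky Iy M mM; apply: contrapT => My.
have [a [m [Mm amE]]] := maximal_left_idealPn mM My.
suff KME : K `&` M = K by apply: My; move: Ky; rewrite -KME => -[].
case: (mM) => lM _ _.
apply: Kmin; [exact: (submod_setI (V := A^o))| |by move=> ? []].
exists (k * m), (k * a * y + i); split.
- split; last by case: lM => _ _; apply.
  rewrite (_ : k * m = k - k * a * y).
    by apply: (submodB (V := A^o)) => //; case: lK => _ _; apply.
  by rewrite -[X in X - _]mulr1 amE mulrDr mulrA addrK.
- by case: lI => _ ID IZ; apply: ID => //; apply: IZ.
- by rewrite addrA -mulrA -mulrDr -amE mulr1.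
Qed.

(** A subquotient U/U0 killed by J is semisimple: a submodule K maximal with
    trivial intersection with W modulo U0 is a complement.  An element w of U
    outside K + W is corrected by the idempotent of the ideal of a with a w in
    K + W, and could then be added to K. *)
Lemma relative_complement (V : lmodType A) (U0 U W : set V) :
  submod U0 -> submod U -> submod W ->
  (forall u x, J u -> U x -> U0 (u *: x)) ->
  exists K, [/\ submod K, U0 `<=` K, K `&` W `<=` U0 & U `<=` sum_sub K W].
Proof.
move=> sU0 sU sW JU.
have [|K [sK U0K KW Kmax]] := @maximal_disjoint_submod _ _ U0 (W `\` U0) sU0.
  by apply/seteqP; split=> // x [? []].
exists K; split=> //.
  move=> x [Kx Wx]; apply: contrapT => nx.
  by have : set0 x by rewrite -KW.
have sKW := submod_sum_sub sK sW.
move=> w Uw; apply: contrapT => nw.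
have lI : left_ideal [set a | sum_sub K W (a *: w)].
  case: sKW => KW0 KWD KWZ; split=> [|a b|a b]; rewrite /= ?scale0r //.
    by rewrite scalerDl; apply: KWD.
  by rewrite -scalerA; apply: KWZ.
have [e /= ew eP] := jacobson_idempotent lI.
pose w' := w - e *: w.
have nw' : ~ sum_sub K W w'.
  move=> w'KW; apply: nw; rewrite -(subrK (e *: w) w).
  by case: sKW => _ KWD _; apply: KWD.
apply: nw'; apply: (sum_subl sW).
rewrite -(Kmax (sum_sub K (cyclic_sub w'))).
- exact/(sum_subr sK)/cyclic_sub_gen.
- exact/submod_sum_sub/submod_cyclic.
- exact/sum_subl/submod_cyclic.
apply/seteqP; split=> // y [[k [_ [Kk [a ->] yE]]] [Wy nU0y]]; apply: nU0y.
suff U0a : U0 (a *: w').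
  have Ky : K y.
    by rewrite yE; case: (sK) => _ KD _; apply: KD => //; apply: U0K.
  apply: contrapT => nU0y.
  by have : set0 y by rewrite -KW.
rewrite scalerBr scalerA -scalerBl; apply: JU => //; apply: eP => /=.
have -> : a *: w = y + (a * e *: w - k).
  by rewrite yE scalerBr scalerA addrC addrA subrK addrC subrK.
case: (sKW) => _ KWD KWZ.
apply: KWD; first exact: (sum_subr sK).
apply: submodB => //; last exact: (sum_subl sW).
by rewrite -scalerA; apply: KWZ.
Qed.

End Radical.

Section Nilpotency.
Variable A : pzRingType.
Local Notation J := (@jacobson A).
Local Notation Jpow := (@jacobson_pow A).

Lemma jacobson_pow_left_ideal n : left_ideal (Jpow n).
Proof.
elim: n => [|n [_ _ IHM]]; first by split.
split=> [|_ _ [k [u [v [Ju Jv ->]]]] [k' [u' [v' [Ju' Jv' ->]]]]|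
    a _ [k [u [v [Ju Jv ->]]]]].
- by exists 0%N, (fun=> 0), (fun=> 0); split=> [[]|[]|] //; rewrite big_ord0.
- exists (k + k')%N,
    (fun l => match split l with inl i => u i | inr i => u' i end),
    (fun l => match split l with inl i => v i | inr i => v' i end).
  split=> [l|l|]; [by case: (split l)|by case: (split l)|].
  rewrite big_split_ord /=; congr (_ + _); apply: eq_bigr => l _.
    by rewrite (unsplitK (inl l)).
  by rewrite (unsplitK (inr l)).
- exists k, (fun l => a * u l), v; split=> // [l|].
    by case: (jacobson_left_ideal A) => _ _; apply.
  by rewrite big_distrr; apply: eq_bigr => l _; rewrite /= mulrA.
Qed.

Lemma jacobson_powS n u v : J u -> Jpow n v -> Jpow n.+1 (u * v).
Proof. by exists 1%N, (fun=> u), (fun=> v); split=> //; rewrite big_ord1. Qed.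

Lemma jacobson_powS_ind n (K : set A) :
  K 0 -> (forall x y, K x -> K y -> K (x + y)) ->
  (forall u v, J u -> Jpow n v -> K (u * v)) -> Jpow n.+1 `<=` K.
Proof.
move=> K0 KD Kuv _ [k [u [v [Ju Jv ->]]]].
by elim/big_ind: _ => // l _; apply: Kuv (Ju l) (Jv l).
Qed.

Lemma jacobson_pow_dec n : Jpow n.+1 `<=` Jpow n.
Proof.
have [K0 KD KM] := jacobson_pow_left_ideal n.
by apply: jacobson_powS_ind => // u v _; apply: KM.
Qed.

Lemma jacobson_powSJ n : Jpow n.+1 `<=` J.
Proof.
have [J0 JD _] := jacobson_left_ideal A.
by apply: jacobson_powS_ind => // u v Ju _; apply: jacobson_mulr.
Qed.

Lemma jacobson_powSr n u v : Jpow n u -> J v -> Jpow n.+1 (u * v).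
Proof.
move=> + Jv; elim: n u => [|n IH] u.
  move=> _; rewrite -[_ * _]mulr1; apply: jacobson_powS => //.
  by case: (jacobson_left_ideal A) => _ _; apply.
have [K0 KD _] := jacobson_pow_left_ideal n.+2.
move: u; apply: jacobson_powS_ind => [|x y|u w Ju Jw]; rewrite ?mul0r //.
  by rewrite mulrDl; apply: KD.
by rewrite -mulrA; apply: jacobson_powS => //; apply: IH.
Qed.

Lemma jacobson_pow_mulr n u c : Jpow n u -> Jpow n (u * c).
Proof.
elim: n u => // n IH u; have [K0 KD _] := jacobson_pow_left_ideal n.+1.
move: u; apply: jacobson_powS_ind => [|x y|u v Ju Jv] /=; rewrite ?mul0r //.
  by rewrite mulrDl; apply: KD.
by rewrite -mulrA; apply: jacobson_powS => //; apply: IH.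
Qed.

Lemma jacobson_powD m n (K : set A) :
  K 0 -> (forall x y, K x -> K y -> K (x + y)) ->
  (forall u v, Jpow m u -> Jpow n v -> K (u * v)) -> Jpow (m + n) `<=` K.
Proof.
elim: m K => [|m IH] K K0 KD Kuv.
  by move=> v Jv; rewrite -[v]mul1r; apply: Kuv.
apply: jacobson_powS_ind => // j v Jj Jv.
suff : [set w | forall i, J i -> K (i * w)] v by apply.
move: v Jv; apply: IH => [i _|x y Kx Ky i Ji|u v Ju Jv i Ji].
- by rewrite mulr0.
- by rewrite mulrDr; apply: KD; [apply: Kx|apply: Ky].
- by rewrite mulrA; apply: Kuv => //; apply: jacobson_powS.
Qed.

Hypothesis hA : left_artinian A.

(** Let I be the stable value of the powers of J, so I = I I.  If I <> 0, let L
    be minimal with I L <> 0 and pick x in L with I x <> 0.  Then I x = L, so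
    x = b x with b in J, which forces x = 0. *)
Lemma jacobson_nilpotent : exists n, Jpow n = [set 0].
Proof.
have [N NE] := hA jacobson_pow_left_ideal jacobson_pow_dec.
exists N; apply: contrapT => N0.
have [a [Ia a0]] : exists a, Jpow N a /\ a <> 0.
  apply: contrapT => na; apply: N0; apply/seteqP; split=> [a Ia|_ ->].
    by apply: contrapT => a0; apply: na; exists a.
  by case: (jacobson_pow_left_ideal N).
have [||L [lL [b [x [Ib Lx bx0]]] Lmin]] := @minimal_left_ideal_ex A hA
    (fun L => exists b x, [/\ Jpow N b, L x & b * x <> 0]) setT.
- by [].
- by exists a, 1; rewrite mulr1.
have [I0 ID IM] := jacobson_pow_left_ideal N.
pose L' := [set y | exists2 c, Jpow N c & y = c * x].
have L'E : L' = L.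
  apply: Lmin.
  - split=> [|_ _ [c Ic ->] [d Id ->]|c _ [d Id ->]].
    + by exists 0; rewrite ?mul0r.
    + by exists (c + d); [apply: ID|rewrite mulrDl].
    + by exists (c * d); [apply: IM|rewrite mulrA].
  - apply: contrapT => nL'; apply: bx0.
    move: b Ib; rewrite -(NE (N + N)%N) ?leq_addr //.
    apply: jacobson_powD => [|u v|u v Iu Iv]; rewrite /= ?mul0r //.
      by rewrite mulrDl => -> ->; rewrite addr0.
    rewrite -mulrA; apply: contrapT => uvx; apply: nL'; exists u, (v * x).
    by split=> //; exists v.
  - by move=> _ [c _ ->]; case: lL => _ _; apply.
have [c Ic xE] : L' x by rewrite L'E.
apply: bx0; rewrite (@jacobson_fixed A c x) ?mulr0 //.
by apply: (@jacobson_powSJ N); rewrite NE.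
Qed.

(** J/J^2 is artinian and semisimple.  If K is minimal such that J is finitely
    generated modulo K, then K = J^2, because a complement to a nonzero cyclic
    part of K/J^2 would be a smaller K. *)
Lemma jacobson_fg_mod_square : exists2 s : seq A, (forall x, x \in s -> J x) &
  forall W, left_ideal W -> (forall x, x \in s -> W x) ->
    J `<=` sum_sub (V := A^o) W (Jpow 2).
Proof.
pose P (K : set A) := [/\ K `<=` J, Jpow 2 `<=` K &
  exists2 s : seq A, (forall x, x \in s -> J x) &
    forall W, left_ideal W -> (forall x, x \in s -> W x) ->
      J `<=` sum_sub (V := A^o) W K].
have lJ := jacobson_left_ideal A; have lJ2 := jacobson_pow_left_ideal 2.
have [|K [lK [KJ J2K [s sJ sP]] Kmin]] := @minimal_left_ideal_ex A hA P J lJ.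
  split=> //; first exact: jacobson_powSJ.
  by exists [::] => // W lW _; apply: (sum_subr (V := A^o)).
exists s => // W lW sW x /(sP W lW sW)[w [k [Ww Kk ->]]].
exists w, k; split=> //.
apply: contrapT => nk; pose C0 := cyclic_sub (V := A^o) k.
have lC0 : submod C0 by apply: submod_cyclic.
have [|C [lC J2C CC0 KC]] := relative_complement hA (V := A^o) lJ2 lK lC0.
  move=> u y Ju /KJ Jy; apply: jacobson_powS => //.
  by rewrite -[y]mulr1; apply: jacobson_powS.
apply: nk; apply: CC0; split; last exact: (cyclic_sub_gen (V := A^o)).
suff CKE : C `&` K = K by move: Kk; rewrite -CKE => -[].
apply: Kmin; [exact: (submod_setI (V := A^o))| |by move=> ? []].
split=> [y [_ /KJ]|y J2y|] //.
  by split; [apply: J2C|apply: J2K].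
exists (k :: s) => [y|W' lW' sW' y Jy].
  by rewrite inE => /orP[/eqP->|/sJ//]; apply: KJ.
have [|w' [k' [W'w' Kk' ->]]] := sP W' lW' _ y Jy.
  by move=> z zs; apply: sW'; rewrite inE zs orbT.
have [c [c0 [Cc C0c0 k'E]]] := KC _ Kk'.
have W'c0 : W' c0.
  by apply: (cyclic_subS (V := A^o) lW' _ C0c0); apply: sW'; rewrite inE eqxx.
exists (w' + c0), c; split; last by rewrite k'E (addrC c) addrA.
  by case: lW' => _ W'D _; apply: W'D.
split=> //; rewrite -(addrK c0 c) -[c + c0]k'E.
apply: (submodB (V := A^o)) => //.
exact: (cyclic_subS (V := A^o) lK Kk).
Qed.

(** If J lies in W + J^2 then it lies in W + J^n for all n, hence in W, since J
    is nilpotent. *)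
Lemma jacobson_fg : exists2 s : seq A, (forall x, x \in s -> J x) &
  forall W, left_ideal W -> (forall x, x \in s -> W x) -> J `<=` W.
Proof.
have [s sJ sP] := jacobson_fg_mod_square; exists s => // W lW sW.
have [N NE] := jacobson_nilpotent.
suff H n : J `<=` sum_sub (V := A^o) W (Jpow n.+1).
  move=> x /(H N)[w [y [Ww /jacobson_pow_dec + ->]]]; rewrite NE => ->.
  by rewrite addr0.
elim: n => [|n IH x Jx].
  move=> x Jx; exists 0, x; split; [by case: lW| |by rewrite add0r].
  by rewrite -[x]mulr1; apply: jacobson_powS.
have sWJ : submod (sum_sub (V := A^o) W (Jpow n.+2)).
  exact: (submod_sum_sub (V := A^o) lW (jacobson_pow_left_ideal n.+2)).
have [w [y [Ww J2y ->]]] := sP W lW sW x Jx.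
case: (sWJ) => WJ0 WJD _; apply: (WJD).
  by apply: (sum_subl (V := A^o)) => //; apply: jacobson_pow_left_ideal.
move: y J2y; apply: jacobson_powS_ind WJ0 WJD _ => u v Ju /jacobson_powSJ /IH.
case=> [w' [z [Ww' Jz ->]]]; exists (u * w'), (u * z).
by split; [case: lW => _ _; apply|apply: jacobson_powS|rewrite mulrDr].
Qed.

End Nilpotency.

(** * Zero objects and direct sums in the derived category *)

#[local] Instance deq_Equivalence A X Y : Equivalence (@deq A X Y).
Proof.
by split=> [f|f g|f g h]; [apply: deq_refl|apply: deq_sym|apply: deq_trans].
Qed.

#[local] Instance dcomp_Proper A X Y Z :
  Proper (@deq A Y Z ==> @deq A X Y ==> @deq A X Z) (@dcomp A X Y Z).
Proof. by move=> g g' gg' f f' ff'; apply: deq_comp. Qed.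

#[local] Hint Resolve deq_refl : core.

Section Derived.
Variable A : pzRingType.
Implicit Types X Y Z W : bcomplex A.

Local Notation "g ∘ f" := (dcomp g f) (at level 50, left associativity).
Local Notation "f ~ g" := (deq f g) (at level 70).

Lemma dinvl X Y Z (s : chain_map X Y) (sq : quasi_iso s) (f : dhom Z X) g :
  dmap s ∘ f ~ g -> dinv sq ∘ g ~ f.
Proof. by move=> <-; rewrite deq_assoc deq_invl deq_idl. Qed.

Lemma dinvr X Y Z (s : chain_map X Y) (sq : quasi_iso s) (f : dhom Y Z) g :
  f ∘ dmap s ~ g -> g ∘ dinv sq ~ f.
Proof. by move=> <-; rewrite -deq_assoc deq_invr deq_idr. Qed.

Lemma quasi_iso_id X : quasi_iso (chain_id X).
Proof.
move=> i j k e e'; split=> [x _ [y xE]|y dy0]; first by exists y.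
by exists y => //; exists 0; rewrite linear0 addr0.
Qed.

Section ZeroObjects.

Program Definition zero_map X Y : chain_map X Y :=
  @ChainMap A X Y (fun i => \0) _.
Next Obligation. by move=> X Y i j e x; rewrite /= linear0. Qed.

Lemma dcomp_zeror X Y Z (g : dhom Y Z) :
  g ∘ dmap (zero_map X Y) ~ dmap (zero_map X Z).
Proof.
elim: g X => {Y Z} [Y Z g|Y Z s sq|Y Z W g IHg f IHf] X.
- by rewrite -deq_map_comp; apply: deq_ext => i x; rewrite /= linear0.
- apply: dinvl; rewrite -deq_map_comp.
  by apply: deq_ext => i x; rewrite /= linear0.
- by rewrite -deq_assoc IHf IHg.
Qed.

Lemma dcomp_zerol X Y Z (f : dhom X Y) :
  dmap (zero_map Y Z) ∘ f ~ dmap (zero_map X Z).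
Proof.
elim: f Z => {X Y} [X Y f|X Y s sq|X Y W g IHg f IHf] Z.
- by rewrite -deq_map_comp; apply: deq_ext.
- by apply: dinvr; rewrite -deq_map_comp; apply: deq_ext.
- by rewrite deq_assoc IHg IHf.
Qed.

Lemma is_zero_Db (X : Db A) : (forall i (x : (X : bcomplex A) i), x = 0) ->
  is_zero X.
Proof.
move=> X0; have id0 : dmap (chain_id X) ~ dmap (zero_map X X).
  by apply: deq_ext => i x; rewrite [x]X0 linear0.
split=> Y.
  by exists (dmap (zero_map X Y)) => g; rewrite /= -[g]deq_idr id0 dcomp_zeror.
by exists (dmap (zero_map Y X)) => g; rewrite /= -[g]deq_idl id0 dcomp_zerol.
Qed.

End ZeroObjects.
Section DirectSum.

Definition dsum_diff X Y (i j : int) (e : i + 1 = j) (p : X i * Y i) :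
    X j * Y j := (diff X e p.1, diff Y e p.2).

Fact dsum_diff_linear X Y i j e : linear (@dsum_diff X Y i j e).
Proof. by move=> a [x y] [x' y']; congr (_, _); rewrite /= linearP. Qed.
HB.instance Definition _ X Y i j e :=
  GRing.isLinear.Build A _ _ *:%R (@dsum_diff X Y i j e)
    (dsum_diff_linear (X := X) (Y := Y) e).

Program Definition dsum X Y : bcomplex A :=
  @BComplex A (fun i => (X i * Y i)%type : lmodType A)
    (fun i j e => @dsum_diff X Y i j e) _ _ _.
Next Obligation.
by move=> X Y i j k e e' [x y]; rewrite /= /dsum_diff /= !diffK.
Qed.
Next Obligation. by move=> X Y i; apply: fg_prod; apply: term_fg. Qed.
Next Obligation.
move=> X Y; have [M XM] := term_bounded X; have [N YN] := term_bounded Y.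
exists (M + N)%N => i iMN [x y].
by rewrite (XM _ _ x) ?(YN _ _ y) //; lia.
Qed.

Definition dsum_map_fun X Y X' Y' (u : chain_map X X') (v : chain_map Y Y') i
  (p : dsum X Y i) : dsum X' Y' i := (u i p.1, v i p.2).

Fact dsum_map_linear X Y X' Y' u v i : linear (@dsum_map_fun X Y X' Y' u v i).
Proof. by move=> a [x y] [x' y']; congr (_, _); rewrite /= linearP. Qed.
HB.instance Definition _ X Y X' Y' u v i :=
  GRing.isLinear.Build A _ _ *:%R (@dsum_map_fun X Y X' Y' u v i)
    (dsum_map_linear u v (i := i)).

Program Definition dsum_map X Y X' Y' u v : chain_map (dsum X Y) (dsum X' Y') :=
  @ChainMap A (dsum X Y) (dsum X' Y') (@dsum_map_fun X Y X' Y' u v) _.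
Next Obligation.
move=> X Y X' Y' u v i j e [x y].
by rewrite /= /dsum_map_fun /dsum_diff /= !cmapE.
Qed.

Definition dsum_inl_fun X Y i (x : X i) : dsum X Y i := (x, 0).
Definition dsum_inr_fun X Y i (y : Y i) : dsum X Y i := (0, y).
Definition codiag_fun X i (p : dsum X X i) : X i := p.1 + p.2.

Fact dsum_inl_linear X Y i : linear (@dsum_inl_fun X Y i).
Proof. by move=> a x x'; congr (_, _); rewrite /= scaler0 addr0. Qed.
Fact dsum_inr_linear X Y i : linear (@dsum_inr_fun X Y i).
Proof. by move=> a x x'; congr (_, _); rewrite /= scaler0 addr0. Qed.
Fact codiag_linear X i : linear (@codiag_fun X i).
Proof.
by move=> a [x y] [x' y']; rewrite /codiag_fun /= scalerDr addrACA.
Qed.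
HB.instance Definition _ X Y i := GRing.isLinear.Build A _ _ *:%R
  (@dsum_inl_fun X Y i) (@dsum_inl_linear X Y i).
HB.instance Definition _ X Y i := GRing.isLinear.Build A _ _ *:%R
  (@dsum_inr_fun X Y i) (@dsum_inr_linear X Y i).
HB.instance Definition _ X i := GRing.isLinear.Build A _ _ *:%R
  (@codiag_fun X i) (@codiag_linear X i).

Program Definition dsum_inl X Y : chain_map X (dsum X Y) :=
  @ChainMap A X (dsum X Y) (@dsum_inl_fun X Y) _.
Next Obligation.
by move=> X Y i j e x; rewrite /= /dsum_diff /dsum_inl_fun /= linear0.
Qed.
Program Definition dsum_inr X Y : chain_map Y (dsum X Y) :=
  @ChainMap A Y (dsum X Y) (@dsum_inr_fun X Y) _.
Next Obligation.
by move=> X Y i j e x; rewrite /= /dsum_diff /dsum_inr_fun /= linear0.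
Qed.
Program Definition codiag X : chain_map (dsum X X) X :=
  @ChainMap A (dsum X X) X (@codiag_fun X) _.
Next Obligation.
by move=> X i j e x; rewrite /= /dsum_diff /codiag_fun /= linearD.
Qed.

Lemma quasi_iso_dsum X Y X' Y' (u : chain_map X X') (v : chain_map Y Y') :
  quasi_iso u -> quasi_iso v -> quasi_iso (dsum_map u v).
Proof.
move=> uq vq i j k e e'.
have [ui us] := uq i j k e e'; have [vi vs] := vq i j k e e'.
split=> [[x y] [dx dy] [[x' y'] [uxE vyE]]|[x' y'] [dx' dy']].
  have [|z ->] := ui x dx; first by exists x'.
  have [|t ->] := vi y dy; first by exists y'.
  by exists (z, t).
have [x dx [z ->]] := us x' dx'; have [y dy [t ->]] := vs y' dy'.
exists (x, y); last by exists (z, t).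
by rewrite /= /dsum_diff /= dx dy.
Qed.

(** The functors - (+) Y and X (+) - on the derived category.  They replace the
    addition of morphisms, which formal composites do not carry: the map
    X (+) Y -> W with components f and g is the codiagonal of W after the sum
    of f and g. *)
Fixpoint dsuml Y X X' (f : dhom X X') : dhom (dsum X Y) (dsum X' Y) :=
  match f with
  | dmap _ _ u => dmap (dsum_map u (chain_id Y))
  | dinv _ _ _ sq => dinv (quasi_iso_dsum sq (@quasi_iso_id Y))
  | dcomp _ _ _ g h => dsuml Y g ∘ dsuml Y h
  end.

Fixpoint dsumr X Y Y' (f : dhom Y Y') : dhom (dsum X Y) (dsum X Y') :=
  match f with
  | dmap _ _ v => dmap (dsum_map (chain_id X) v)
  | dinv _ _ _ sq => dinv (quasi_iso_dsum (@quasi_iso_id X) sq)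
  | dcomp _ _ _ g h => dsumr X g ∘ dsumr X h
  end.

Lemma dsuml_deq Y X X' (f g : dhom X X') : f ~ g -> dsuml Y f ~ dsuml Y g.
Proof.
have id1 W : dmap (dsum_map (chain_id W) (chain_id Y)) ~
    dmap (chain_id (dsum W Y)) by apply: deq_ext => i [].
elim=> {X X' f g} /=.
- by [].
- by move=> X X' f g _ ->.
- by move=> X X' f g h _ -> _ ->.
- by move=> X X' X'' g g' f f' _ -> _ ->.
- by move=> *; apply: deq_assoc.
- by move=> X X' f; rewrite id1 deq_idl.
- by move=> X X' f; rewrite id1 deq_idr.
- move=> X X' f g fg; apply: deq_ext => i [x y].
  by rewrite /= /dsum_map_fun /= fg.
- by move=> X X' X'' g f; rewrite -deq_map_comp; apply: deq_ext.
- by move=> X X' s sq; rewrite deq_invl id1.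
- by move=> X X' s sq; rewrite deq_invr id1.
Qed.

Lemma dsumr_deq X Y Y' (f g : dhom Y Y') : f ~ g -> dsumr X f ~ dsumr X g.
Proof.
have id1 W : dmap (dsum_map (chain_id X) (chain_id W)) ~
    dmap (chain_id (dsum X W)) by apply: deq_ext => i [].
elim=> {Y Y' f g} /=.
- by [].
- by move=> Y Y' f g _ ->.
- by move=> Y Y' f g h _ -> _ ->.
- by move=> Y Y' Y'' g g' f f' _ -> _ ->.
- by move=> *; apply: deq_assoc.
- by move=> Y Y' f; rewrite id1 deq_idl.
- by move=> Y Y' f; rewrite id1 deq_idr.
- move=> Y Y' f g fg; apply: deq_ext => i [x y].
  by rewrite /= /dsum_map_fun /= fg.
- by move=> Y Y' Y'' g f; rewrite -deq_map_comp; apply: deq_ext.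
- by move=> Y Y' s sq; rewrite deq_invl id1.
- by move=> Y Y' s sq; rewrite deq_invr id1.
Qed.

Lemma dinv_square X Y X' Y' (s : chain_map X Y) (sq : quasi_iso s)
    (t : chain_map X' Y') (tq : quasi_iso t) (f : dhom X X') (g : dhom Y Y') :
  dmap t ∘ f ~ g ∘ dmap s -> f ∘ dinv sq ~ dinv tq ∘ g.
Proof.
move=> fg; symmetry; apply: dinvl.
by rewrite deq_assoc fg -deq_assoc deq_invr deq_idr.
Qed.

Lemma dsuml_natural X X' Y Y' (f : dhom X X') (v : chain_map Y Y') :
  dsuml Y' f ∘ dmap (dsum_map (chain_id X) v) ~
  dmap (dsum_map (chain_id X') v) ∘ dsuml Y f.
Proof.
elim: f => {X X'} [X X' u|X X' s sq|X X' X'' g IHg f IHf] /=.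
- by rewrite -!deq_map_comp; apply: deq_ext.
- symmetry; apply: dinv_square; rewrite -!deq_map_comp.
  by apply: deq_ext.
- by rewrite -deq_assoc IHf deq_assoc IHg deq_assoc.
Qed.

Lemma dsumr_natural X X' Y Y' (g : dhom Y Y') (u : chain_map X X') :
  dsumr X' g ∘ dmap (dsum_map u (chain_id Y)) ~
  dmap (dsum_map u (chain_id Y')) ∘ dsumr X g.
Proof.
elim: g => {Y Y'} [Y Y' v|Y Y' s sq|Y Y' Y'' g IHg f IHf] /=.
- by rewrite -!deq_map_comp; apply: deq_ext.
- symmetry; apply: dinv_square; rewrite -!deq_map_comp.
  by apply: deq_ext.
- by rewrite -deq_assoc IHf deq_assoc IHg deq_assoc.
Qed.

Lemma dsum_interchange X X' Y Y' (f : dhom X X') (g : dhom Y Y') :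
  dsuml Y' f ∘ dsumr X g ~ dsumr X' g ∘ dsuml Y f.
Proof.
elim: g => {Y Y'} [Y Y' v|Y Y' s sq|Y Y' Y'' g IHg h IHh] /=.
- exact: dsuml_natural.
- by apply: dinv_square; symmetry; apply: dsuml_natural.
- by rewrite deq_assoc IHg -deq_assoc IHh deq_assoc.
Qed.

Lemma dsuml_inl Y X X' (f : dhom X X') :
  dsuml Y f ∘ dmap (dsum_inl X Y) ~ dmap (dsum_inl X' Y) ∘ f.
Proof.
elim: f => {X X'} [X X' u|X X' s sq|X X' X'' g IHg f IHf] /=.
- rewrite -!deq_map_comp; apply: deq_ext => i x.
  by rewrite /= /dsum_map_fun.
- symmetry; apply: dinv_square; rewrite -!deq_map_comp.
  by apply: deq_ext.
- by rewrite -deq_assoc IHf deq_assoc IHg deq_assoc.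
Qed.

Lemma dsuml_inr Y X X' (f : dhom X X') :
  dsuml Y f ∘ dmap (dsum_inr X Y) ~ dmap (dsum_inr X' Y).
Proof.
elim: f => {X X'} [X X' u|X X' s sq|X X' X'' g IHg f IHf] /=.
- rewrite -!deq_map_comp; apply: deq_ext => i x.
  by rewrite /= /dsum_map_fun /= linear0.
- apply: dinvl; rewrite -!deq_map_comp.
  by apply: deq_ext => i x; rewrite /= /dsum_map_fun /= linear0.
- by rewrite -deq_assoc IHf IHg.
Qed.

Lemma dsumr_inr X Y Y' (g : dhom Y Y') :
  dsumr X g ∘ dmap (dsum_inr X Y) ~ dmap (dsum_inr X Y') ∘ g.
Proof.
elim: g => {Y Y'} [Y Y' v|Y Y' s sq|Y Y' Y'' g IHg f IHf] /=.
- rewrite -!deq_map_comp; apply: deq_ext => i x.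
  by rewrite /= /dsum_map_fun.
- symmetry; apply: dinv_square; rewrite -!deq_map_comp.
  by apply: deq_ext.
- by rewrite -deq_assoc IHf deq_assoc IHg deq_assoc.
Qed.

Lemma dsumr_inl X Y Y' (g : dhom Y Y') :
  dsumr X g ∘ dmap (dsum_inl X Y) ~ dmap (dsum_inl X Y').
Proof.
elim: g => {Y Y'} [Y Y' v|Y Y' s sq|Y Y' Y'' g IHg f IHf] /=.
- rewrite -!deq_map_comp; apply: deq_ext => i x.
  by rewrite /= /dsum_map_fun /= linear0.
- apply: dinvl; rewrite -!deq_map_comp.
  by apply: deq_ext => i x; rewrite /= /dsum_map_fun /= linear0.
- by rewrite -deq_assoc IHf IHg.
Qed.

Lemma codiag_natural X Y (f : dhom X Y) :
  f ∘ dmap (codiag X) ~ dmap (codiag Y) ∘ (dsuml Y f ∘ dsumr X f).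
Proof.
elim: f => {X Y} [X Y u|X Y s sq|X Y Z g IHg f IHf] /=.
- rewrite -!deq_map_comp; apply: deq_ext => i x.
  by rewrite /= /codiag_fun /= linearD.
- apply: dinvl; rewrite deq_assoc -deq_map_comp.
  rewrite (_ : dmap (chain_comp s (codiag X)) ~ dmap (codiag Y) ∘
    (dmap (dsum_map (chain_id Y) s) ∘ dmap (dsum_map s (chain_id X)))).
    rewrite -!deq_assoc.
    rewrite (deq_assoc (dmap (dsum_map s _))) deq_invr deq_idl.
    by rewrite deq_invr deq_idr.
  rewrite -!deq_map_comp; apply: deq_ext => i x.
  by rewrite /= /codiag_fun /= linearD.
- rewrite -deq_assoc IHf deq_assoc IHg -!deq_assoc; apply: deq_comp => //.
  apply: deq_comp => //; rewrite !deq_assoc; apply: deq_comp => //.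
  by symmetry; apply: dsum_interchange.
Qed.

(** Uniqueness: the identity of X (+) Y is the codiagonal after the sum of the
    two injections, and h commutes with codiagonals, so h is determined by its
    composites with the injections. *)
Lemma is_sum_dsum X Y : is_sum (T := Db A) X Y (dsum X Y).
Proof.
exists (dmap (dsum_inl X Y)), (dmap (dsum_inr X Y)) => W f g.
exists (dmap (codiag W) ∘ (dsuml W f ∘ dsumr X g)); split=> /=.
- rewrite -!deq_assoc dsumr_inl dsuml_inl deq_assoc -deq_map_comp.
  rewrite -[X in _ ~ X]deq_idl; apply: deq_comp => //.
  by apply: deq_ext => i x; rewrite /= /codiag_fun /= addr0.
- rewrite -!deq_assoc dsumr_inr (deq_assoc (dsuml W f)) dsuml_inr.
  rewrite deq_assoc -deq_map_comp -[X in _ ~ X]deq_idl; apply: deq_comp => //.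
  by apply: deq_ext => i x; rewrite /= /codiag_fun /= add0r.
move=> h hl hr.
have idE : dmap (chain_id (dsum X Y)) ~ dmap (codiag (dsum X Y)) ∘
    (dmap (dsum_map (dsum_inl X Y) (chain_id (dsum X Y))) ∘
      dmap (dsum_map (chain_id X) (dsum_inr X Y))).
  rewrite -!deq_map_comp; apply: deq_ext => i [x y].
  by congr (_, _); rewrite /= ?addr0 ?add0r.
rewrite -[h]deq_idr idE deq_assoc codiag_natural -!deq_assoc.
apply: deq_comp => //.
rewrite (deq_assoc (dsumr _ h)) dsumr_natural -deq_assoc.
rewrite deq_assoc; apply: deq_comp; first exact: (dsuml_deq W hl).
exact: (dsumr_deq X hr).
Qed.

End DirectSum.
Section Generation.
Variable I : Db A -> Prop.

Program Definition zero_complex : bcomplex A :=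
  @BComplex A (fun=> 'rV[A]_0) (fun _ _ _ => \0) _ _ _.
Next Obligation. by []. Qed.
Next Obligation.
move=> i; exists 0%N, (fun=> 0) => v; exists (fun=> 0).
by rewrite big_ord0; apply/rowP => -[].
Qed.
Next Obligation. by exists 0%N => i _ x; apply/rowP => -[]. Qed.

Lemma zero_complex_eq0 i (x : zero_complex i) : x = 0.
Proof. by apply/rowP => -[]. Qed.

(** X is a direct sum of Y and 0, so Y is a direct summand of X. *)
Lemma gen_iso X Y (f : dhom X Y) (g : dhom Y X) :
  f ∘ g ~ dmap (chain_id Y) -> g ∘ f ~ dmap (chain_id X) ->
  gen (T := Db A) I X -> gen (T := Db A) I Y.
Proof.
move=> fg gf; apply: (@gen_summand (Db A) I Y zero_complex X).
exists g, (dmap (zero_map zero_complex X)) => W a b /=.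
have [/(_ W)[z /= zP] _] := is_zero_Db (X := zero_complex) zero_complex_eq0.
exists (a ∘ f); split=> [|| h ha _] /=.
- by rewrite -deq_assoc fg deq_idr.
- by rewrite (zP b) (zP (_ ∘ _)).
- by rewrite -ha -deq_assoc gf deq_idr.
Qed.

Lemma gen_quasi_iso X Y (s : chain_map X Y) : quasi_iso s ->
  gen (T := Db A) I X <-> gen (T := Db A) I Y.
Proof.
move=> sq; split.
- exact: gen_iso (deq_invr sq) (deq_invl sq).
- exact: gen_iso (deq_invl sq) (deq_invr sq).
Qed.

Lemma gen_dsum X Y : gen (T := Db A) I X -> gen (T := Db A) I Y ->
  gen (T := Db A) I (dsum X Y).
Proof. exact: gen_sum (is_sum_dsum X Y). Qed.

Lemma gen_dsuml X Y : gen (T := Db A) I (dsum X Y) -> gen (T := Db A) I X.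
Proof. exact: gen_summand (is_sum_dsum X Y). Qed.

End Generation.

End Derived.

(** * Submodules and quotient modules as modules *)

Section SubQuotientModules.
Variable A : pzRingType.
Implicit Type V : lmodType A.

Lemma fg_moduleP V : fg_module V <->
  exists s : seq V, forall W, submod W -> (forall x, x \in s -> W x) ->
    forall v, W v.
Proof.
split=> [[n [g gP]]|[s sP]].
  exists (codom g) => W sW Wg v; have [c ->] := gP v.
  apply: submod_sum => // l; case: sW => _ _; apply.
  exact/Wg/codom_f.
exists (size s), (fun l => s`_l); apply: sP.
  split=> [|_ _ [c ->] [d ->]|a _ [c ->]].
  - by exists (fun=> 0); rewrite big1 // => l _; rewrite scale0r.
  - exists (fun l => c l + d l); rewrite -big_split; apply: eq_bigr => l _.
    by rewrite /= scalerDl.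
  - exists (fun l => a * c l); rewrite scaler_sumr; apply: eq_bigr => l _.
    by rewrite scalerA.
move=> x xs; have ix : (index x s < size s)%N by rewrite index_mem.
exists (fun l => (l == Ordinal ix)%:R); rewrite (bigD1 (Ordinal ix)) //= eqxx.
rewrite scale1r nth_index // big1 ?addr0 // => l /negPf ->.
by rewrite scale0r.
Qed.

Section Submodule.
Variables (V : lmodType A) (W : set V).

(** The proof sW is an argument so that instances can be attached to the head
    constant. *)
Definition submod_pred (sW : submod W) : {pred V} := fun v => `[< W v >].

Variable sW : submod W.

Fact submod_pred_closed : subsemimod_closed (submod_pred sW).
Proof.
case: sW => W0 WD WZ; split; first split.
- exact/asboolP.
- by move=> x y /asboolP Wx /asboolP Wy; apply/asboolP; apply: WD.
- by move=> a x /asboolP Wx; apply/asboolP; apply: WZ.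
Qed.
HB.instance Definition _ :=
  GRing.isSubmodClosed.Build A V (submod_pred sW) submod_pred_closed.

Record subm := Subm { subm_val : V; _ : subm_val \in submod_pred sW }.
HB.instance Definition _ := [isSub for subm_val].
HB.instance Definition _ := [Choice of subm by <:].
HB.instance Definition _ := [SubChoice_isSubLmodule of subm by <:].

Lemma subm_valP (w : subm) : W (val w).
Proof. exact/asboolP/(valP w). Qed.

Definition to_subm x (Wx : W x) : subm :=
  Subm (asboolT Wx : x \in submod_pred sW).

Lemma fg_subm (s : seq V) : (forall x, x \in s -> W x) ->
  (forall U, submod U -> (forall x, x \in s -> U x) -> W `<=` U) ->
  fg_module subm.
Proof.
move=> sWs sP; apply/fg_moduleP; exists (pmap insub s) => U [U0 UD UZ] Us w.
pose U' := [set v | exists2 w, U w & v = val w].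
have [||w' Uw' /val_inj-> //] := sP U' _ _ _ (subm_valP w).
- split=> [|_ _ [x Ux ->] [y Uy ->]|a _ [x Ux ->]].
  + by exists 0; rewrite ?raddf0.
  + by exists (x + y); [apply: UD|rewrite raddfD].
  + by exists (a *: x); [apply: UZ|rewrite linearZ].
- move=> x xs; exists (to_subm (sWs x xs)) => //.
  by apply: Us; rewrite mem_pmap_sub.
Qed.

Definition quotm : Type := @Quotient.quot V (submod_pred sW).
HB.instance Definition _ := GRing.Zmodule.on quotm.
HB.instance Definition _ := EqQuotient.on quotm.

Definition quotm_pi (x : V) : quotm := \pi_quotm x.

Lemma quotm_piK q : quotm_pi (repr q) = q. Proof. exact: reprK. Qed.

Lemma quotm_piP x y : quotm_pi x = quotm_pi y <-> W (x - y).
Proof.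
have := @Quotient.idealrBE V (submod_pred sW) x y.
rewrite unfold_in => E; split=> [xy|Wxy].
  by apply/asboolP; rewrite [X in is_true X]E; apply/eqP.
by apply/eqP; have := asboolT Wxy; rewrite [X in is_true X -> _]E.
Qed.

Lemma quotm_piD x y : quotm_pi (x + y) = quotm_pi x + quotm_pi y.
Proof. exact: (@Quotient.pi_add V (submod_pred sW) x y). Qed.

Definition quotm_scale (a : A) (q : quotm) : quotm := quotm_pi (a *: repr q).

Lemma quotm_scale_pi a x : quotm_scale a (quotm_pi x) = quotm_pi (a *: x).
Proof.
case: (sW) => _ _ WZ.
by apply/quotm_piP; rewrite -scalerBr; apply: WZ; apply/quotm_piP/quotm_piK.
Qed.

Fact quotm_scaleA a b q :
  quotm_scale a (quotm_scale b q) = quotm_scale (a * b) q.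
Proof.
by rewrite -(quotm_piK q) (quotm_scale_pi b) !quotm_scale_pi scalerA.
Qed.

Fact quotm_scale1 : left_id 1 quotm_scale.
Proof. by move=> q; rewrite -(quotm_piK q) quotm_scale_pi scale1r. Qed.

Fact quotm_scaleDr : right_distributive quotm_scale +%R.
Proof.
move=> a p q; rewrite -(quotm_piK p) -(quotm_piK q) -quotm_piD.
by rewrite !quotm_scale_pi scalerDr quotm_piD.
Qed.

Fact quotm_scaleDl q : {morph quotm_scale^~ q : a b / a + b}.
Proof.
move=> a b; rewrite -(quotm_piK q) !quotm_scale_pi.
by rewrite scalerDl quotm_piD.
Qed.

HB.instance Definition _ := GRing.Zmodule_isLmodule.Build A quotm
  quotm_scaleA quotm_scale1 quotm_scaleDr quotm_scaleDl.

Fact quotm_pi_linear : linear quotm_pi.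
Proof.
by move=> a x y; rewrite quotm_piD -quotm_scale_pi.
Qed.
HB.instance Definition _ :=
  GRing.isLinear.Build A V quotm *:%R quotm_pi quotm_pi_linear.

Lemma quotm_pi_eq0 x : quotm_pi x = 0 <-> W x.
Proof. by rewrite -(linear0 quotm_pi) quotm_piP subr0. Qed.

Lemma fg_quotm : fg_module V -> fg_module quotm.
Proof.
move=> [n [g gP]]; exists n, (quotm_pi \o g) => q; have [c cE] := gP (repr q).
exists c; rewrite -[q]quotm_piK cE linear_sum.
by apply: eq_bigr => l _; rewrite linearZ.
Qed.

End Submodule.

Definition complement V (U K : set V) : Prop :=
  [/\ submod K, forall x, U x -> K x -> x = 0 & forall v, sum_sub U K v].

Lemma complement_sym V (U K : set V) :
  submod U -> complement U K -> complement K U.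
Proof.
move=> sU [sK UK0 UKT]; split=> // [x Kx Ux|v]; first exact: UK0.
by have [u [k [Uu Kk ->]]] := UKT v; exists k, u; rewrite addrC.
Qed.

Lemma fg_complement V (U K : set V) (sU : submod U) :
  fg_module V -> complement U K -> fg_module (subm sU).
Proof.
move=> /fg_moduleP[s sP] [sK UK0 UKT].
have /choice[f fP] : forall v, exists u, U u /\ K (v - u).
  by move=> v; have [u [k [Uu Kk ->]]] := UKT v; exists u; rewrite addrC addKr.
apply: (@fg_subm _ _ sU (map f s)) => [_ /mapP[x _ ->]|U' sU' sub x Ux].
  by case: (fP x).
(* The generators s lie in U' + K, since U' contains their U-components. *)
have [u [k [[U'u Uu] Kk xE]]] : sum_sub (U' `&` U) K x.
  apply: sP => [|y ys]; first exact/submod_sum_sub/sK/submod_setI.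
  have [Ufy Kfy] := fP y; exists (f y), (y - f y); split=> //.
    by split=> //; apply: sub; apply: map_f.
  by rewrite addrC subrK.
suff k0 : k = 0 by rewrite xE k0 addr0.
by apply: UK0 => //; rewrite -(addKr u k) -xE addrC; apply: submodB.
Qed.

Definition killed_by_jacobson V : Prop :=
  forall u (x : V), @jacobson A u -> u *: x = 0.

Lemma complement_ex V (U : set V) : left_artinian A -> killed_by_jacobson V ->
  submod U -> exists K, complement U K.
Proof.
move=> hA JV sU.
have [|K [sK _ KU UK]] := relative_complement hA (submod_set0 V)
    (U := setT) _ sU (fun u x Ju _ => JV u x Ju).
  by [].
exists K; split=> // [x Ux Kx|v]; first by apply: KU.
by have [k [u [Kk Uu ->]]] := UK v I; exists u, k; rewrite addrC.
Qed.

End SubQuotientModules.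

(** * Subcomplexes, quotient complexes and their triangle *)

Section Subcomplexes.
Variable A : pzRingType.
Implicit Types X Y : bcomplex A.

Lemma quasi_iso_bij X Y (f : chain_map X Y) :
  (forall i x, f i x = 0 -> x = 0) -> (forall i y, exists x, y = f i x) ->
  quasi_iso f.
Proof.
move=> finj fsurj i j k e e'; split=> [x _ [y fxE]|y dy0].
  have [z yE] := fsurj i y; exists z; apply/eqP; rewrite -subr_eq0; apply/eqP.
  by apply: (finj j); rewrite linearB fxE yE -cmapE subrr.
have [x yE] := fsurj j y; exists x; last by exists 0; rewrite linear0 addr0.
by apply: (finj k); rewrite cmapE -yE.
Qed.

(** The set of boundaries in degree j does not depend on the choice of the index
    i and of the proof of i + 1 = j. *)
Lemma diff_reindex X (i i' j : int) (e : i + 1 = j) (e' : i' + 1 = j)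
    (x : X i) :
  exists x' : X i', diff X e x = diff X e' x'.
Proof.
have ii' : i = i' by apply: (addIr 1); rewrite e e'.
by case: i' / ii' e' => e'; exists x; rewrite (eq_irrelevance e e').
Qed.

Section Family.
Variables (X : bcomplex A) (U : forall i, set (X i)).
Arguments U : clear implicits.
Hypothesis sU : forall i, submod (U i).
Hypothesis dU : forall (i j : int) (e : i + 1 = j) x, U i x -> U j (diff X e x).
Arguments dU [i j] e [x].

Section Sub.
Hypothesis fgU : forall i, fg_module (subm (sU i)).

Definition subcx_diff i j (e : i + 1 = j) (w : subm (sU i)) : subm (sU j) :=
  to_subm (sU j) (dU e (subm_valP w)).

Fact subcx_diff_linear i j e : linear (@subcx_diff i j e).
Proof. by move=> a v w; apply: val_inj; rewrite /= linearP. Qed.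
HB.instance Definition _ i j e := GRing.isLinear.Build A _ _ *:%R
  (@subcx_diff i j e) (@subcx_diff_linear i j e).

Program Definition subcx : bcomplex A :=
  @BComplex A (fun i => subm (sU i)) (fun i j e => @subcx_diff i j e) _ fgU _.
Next Obligation. by move=> i j k e e' x; apply: val_inj; rewrite /= diffK. Qed.
Next Obligation.
have [N XN] := term_bounded X; exists N => i iN x.
by apply: val_inj; apply: XN.
Qed.

Definition subcx_incl_fun i (w : subcx i) : X i := val w.
Fact subcx_incl_linear i : linear (@subcx_incl_fun i).
Proof. by []. Qed.
HB.instance Definition _ i := GRing.isLinear.Build A _ _ *:%R
  (@subcx_incl_fun i) (@subcx_incl_linear i).

Program Definition subcx_incl : chain_map subcx X :=
  @ChainMap A subcx X subcx_incl_fun _.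
Next Obligation. by []. Qed.

End Sub.

Definition quotcx_diff i j (e : i + 1 = j) (q : quotm (sU i)) : quotm (sU j) :=
  quotm_pi (sU j) (diff X e (repr q)).

Lemma quotcx_diff_pi i j (e : i + 1 = j) x :
  quotcx_diff e (quotm_pi (sU i) x) = quotm_pi (sU j) (diff X e x).
Proof.
apply/quotm_piP; rewrite -linearB; apply: dU.
by apply/(quotm_piP (sU i)); rewrite quotm_piK.
Qed.

Fact quotcx_diff_linear i j e : linear (@quotcx_diff i j e).
Proof.
move=> a p q; rewrite -[p]quotm_piK -[q]quotm_piK -linearP !quotcx_diff_pi.
by rewrite -linearP -linearP.
Qed.
HB.instance Definition _ i j e := GRing.isLinear.Build A _ _ *:%R
  (@quotcx_diff i j e) (@quotcx_diff_linear i j e).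

Program Definition quotcx : bcomplex A :=
  @BComplex A (fun i => quotm (sU i)) (fun i j e => @quotcx_diff i j e) _ _ _.
Next Obligation.
move=> i j k e e' q; rewrite /= -[q]quotm_piK !quotcx_diff_pi diffK.
exact: linear0.
Qed.
Next Obligation. by move=> i; apply: fg_quotm; apply: term_fg. Qed.
Next Obligation.
have [N XN] := term_bounded X; exists N => i iN q.
by rewrite -[q]quotm_piK (XN i iN (repr q)) linear0.
Qed.

Program Definition quotcx_proj : chain_map X quotcx :=
  @ChainMap A X quotcx (fun i => quotm_pi (sU i)) _.
Next Obligation. by move=> i j e x; rewrite /= quotcx_diff_pi. Qed.

Section ConeQuotient.
Hypothesis fgU : forall i, fg_module (subm (sU i)).

Definition cone_quot_fun i (p : cone (subcx_incl fgU) i) : quotcx i :=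
  quotm_pi (sU i) p.2.
Fact cone_quot_linear i : linear (@cone_quot_fun i).
Proof. by move=> a p q; rewrite /cone_quot_fun /= linearP. Qed.
HB.instance Definition _ i := GRing.isLinear.Build A _ _ *:%R
  (@cone_quot_fun i) (@cone_quot_linear i).

Lemma term_cast_subm i j (e : i = j) x : U i x -> U j (term_cast e x).
Proof. by case: j / e. Qed.

Program Definition cone_quot : chain_map (cone (subcx_incl fgU)) quotcx :=
  @ChainMap A _ quotcx cone_quot_fun _.
Next Obligation.
move=> i j e [u x]; rewrite /= /cone_quot_fun /= quotcx_diff_pi.
apply/quotm_piP; rewrite addrK; apply: term_cast_subm.
exact: (subm_valP u).
Qed.

(** If x is a cycle modulo U then (- dx, x) is a cycle of the cone; this lifts
    cohomology classes of X/U. *)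
Lemma quasi_iso_cone_quot : quasi_iso cone_quot.
Proof.
move=> i j k e e'; case: k / e'; case: j / e; split.
- move=> [u x] /(congr1 snd) /= /addr0_eq uE [q].
  rewrite -[q]quotm_piK /= quotcx_diff_pi => /quotm_piP Uz.
  exists (to_subm (sU _) Uz, repr q).
  congr (_, _); last by rewrite /= /subcx_incl_fun /= subrK.
  apply: val_inj; rewrite /= (eq_irrelevance (shift_idx 1 erefl) erefl).
  by rewrite linearB diffK subr0 -uE opprK.
- move=> q; rewrite -[q]quotm_piK /= quotcx_diff_pi => /quotm_pi_eq0 Udx.
  exists (- to_subm (sU _) Udx, repr q).
    2: by exists 0; rewrite linear0 addr0.
  rewrite /= /cone_diff /=; congr (_, _).
    apply: val_inj; rewrite /= (eq_irrelevance (shift_idx 1 erefl) erefl).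
    by rewrite linearN diffK !oppr0.
  by rewrite /subcx_incl_fun /= addNr.
Qed.

(** X is an extension of X/U by U: the cone of the inclusion of U in X is
    quasi-isomorphic to X/U. *)
Lemma star_subcx_quotcx (I1 I2 : Db A -> Prop) :
  I1 (subcx fgU : Db A) -> I2 (quotcx : Db A) -> star (T := Db A) I1 I2 X.
Proof.
move=> I1U I2Q; exists (subcx fgU), quotcx.
exists (dmap (subcx_incl fgU)), (dmap quotcx_proj),
  (dcomp (dmap (cone_out (subcx_incl fgU))) (dinv quasi_iso_cone_quot)).
split=> //; exists (subcx fgU), X, (subcx_incl fgU).
exists (dmap (chain_id _)), (dmap (chain_id _)), (dinv quasi_iso_cone_quot).
have iso_id Y : diso (dmap (chain_id Y)).
  by exists (dmap (chain_id Y)); split; apply: deq_idl.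
split; split=> //.
- exists (dmap cone_quot).
  by split; [apply: deq_invr|apply: deq_invl].
- by rewrite deq_idl deq_idr.
- rewrite deq_idr; apply: dinvl; rewrite -deq_map_comp.
  by apply: deq_ext.
- by rewrite dshift_id deq_idl.
Qed.

End ConeQuotient.

End Family.

End Subcomplexes.

(** * Complexes of semisimple modules *)

Section Semisimple.
Variable A : pzRingType.
Hypothesis hA : left_artinian A.
Implicit Types X Y : bcomplex A.

Local Notation genJ := (gen (T := Db A) (only (quoJ_Db A))).

Definition zero_diff X : Prop :=
  forall (i j : int) (e : i + 1 = j) x, diff X e x = 0.

Lemma zero_diff_stable X (dX : zero_diff X) (W : forall i, set (X i))
    (sW : forall i, submod (@W i)) (i j : int) (e : i + 1 = j) x :
  W i x -> W j (diff X e x).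
Proof. by rewrite dX; case: (sW j). Qed.

Section Split.
Variables (X : bcomplex A) (U K : forall i, set (X i)).
Arguments U : clear implicits.
Arguments K : clear implicits.
Hypothesis sU : forall i, submod (U i).
Hypothesis sK : forall i, submod (K i).
Hypothesis dU : forall (i j : int) (e : i + 1 = j) x, U i x -> U j (diff X e x).
Hypothesis dK : forall (i j : int) (e : i + 1 = j) x, K i x -> K j (diff X e x).
Hypothesis fgU : forall i, fg_module (subm (sU i)).
Hypothesis fgK : forall i, fg_module (subm (sK i)).
Hypothesis UK : forall i, complement (U i) (K i).

Lemma quasi_iso_split : quasi_iso (chain_comp (codiag X)
  (dsum_map (subcx_incl dU fgU) (subcx_incl dK fgK))).
Proof.
apply: quasi_iso_bij => i.
  move=> [u k] /addr0_eq /= uk; case: (UK i) => _ UK0 _.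
  have k0 : val k = 0.
    apply: UK0; last exact: subm_valP.
    rewrite -[val k]uk; apply: submodN => //; exact: subm_valP.
  have u0 : val u = 0.
    by rewrite -[val u]opprK [- val u]uk [subcx_incl_fun k]k0 oppr0.
  by congr (_, _); apply: val_inj.
move=> x; case: (UK i) => _ _ /(_ x)[u [k [Uu Kk ->]]].
by exists (to_subm (sU i) Uu, to_subm (sK i) Kk).
Qed.

Lemma gen_split I : gen (T := Db A) I X <->
  gen (T := Db A) I (dsum (subcx dU fgU) (subcx dK fgK)).
Proof. by rewrite (gen_quasi_iso I quasi_iso_split). Qed.

End Split.

Section StalkMaps.
Variables (V W : lmodType A) (f : {linear V -> W}).

Definition stalk_out (i : int) : stalk_term V i -> W :=
  if i == 0 as b return (if b then V else 'M[A]_(0, 0) : lmodType A) -> W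
  then f else fun=> 0.

Lemma stalk_out_linear i : linear (@stalk_out i).
Proof.
rewrite /stalk_out /stalk_term; case: (i == 0) => a x y.
  exact: linearP.
by rewrite scaler0 addr0.
Qed.
HB.instance Definition _ i := GRing.isLinear.Build A _ _ *:%R
  (@stalk_out i) (@stalk_out_linear i).

Lemma stalk_out_surj i v :
  i = 0 -> exists x : stalk_term V i, stalk_out x = f v.
Proof. by move=> ->; exists v. Qed.

End StalkMaps.

Lemma quoJ_killed : killed_by_jacobson (quoJ A).
Proof.
move=> u q Ju; rewrite -[q]quoJ_pi_repr [LHS]quoJ_scale_pi.
have -> : 0 = quoJ_pi (0 : A).
  by apply: (addrI (quoJ_pi 0)); rewrite -quoJ_piD !addr0.
by apply/quoJ_piP; rewrite subr0; apply: jacobson_mulr.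
Qed.

Lemma stalk_killed (V : lmodType A) i : killed_by_jacobson V ->
  killed_by_jacobson (stalk_term V i).
Proof.
move=> JV; rewrite /stalk_term; case: (i == 0) => // u x _.
by apply/matrixP => -[].
Qed.

Section CyclicMap.
Variables (V : lmodType A) (x : V).

(** The map from A/J that sends 1 to x. *)
Definition quoJ_out (JV : killed_by_jacobson V) (q : quoJ A) : V := repr q *: x.

Variable JV : killed_by_jacobson V.

Lemma quoJ_out_pi a : quoJ_out JV (quoJ_pi a) = a *: x.
Proof.
apply/eqP; rewrite -subr_eq0 -scalerBl; apply/eqP/JV.
exact/quoJ_piP/quoJ_pi_repr.
Qed.

Fact quoJ_out_linear : linear (quoJ_out JV).
Proof.
move=> a p q; rewrite -[p]quoJ_pi_repr -[q]quoJ_pi_repr.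
rewrite [a *: _]quoJ_scale_pi -quoJ_piD !quoJ_out_pi.
by rewrite scalerDl scalerA.
Qed.
HB.instance Definition _ :=
  GRing.isLinear.Build A _ _ *:%R (quoJ_out JV) quoJ_out_linear.
End CyclicMap.

(** The kernel of f has a complement in X, which f maps isomorphically to Y. *)
Lemma gen_quotient X Y (f : chain_map X Y) I :
  zero_diff X -> zero_diff Y -> (forall i, killed_by_jacobson (X i)) ->
  (forall i y, exists x, y = f i x) ->
  gen (T := Db A) I X -> gen (T := Db A) I Y.
Proof.
move=> dX dY JX fsurj.
pose N i : set (X i) := [set x | f i x = 0].
have sN i : submod (@N i).
  split=> [|x y|a x]; rewrite /N /= ?linear0 //.
    by rewrite linearD => -> ->; rewrite addr0.
  by rewrite linearZZ => ->; rewrite scaler0.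
have NK_ex i := complement_ex hA (JX i) (sN i).
pose K i := projT1 (cid (NK_ex i)).
have NK i : complement (@N i) (K i) := projT2 (cid (NK_ex i)).
have sK i : submod (K i) by case: (NK i).
have KN i := complement_sym (sN i) (NK i).
have d0 := zero_diff_stable dX.
have fgN i := fg_complement (sN i) (term_fg X i) (NK i).
have fgK i := fg_complement (sK i) (term_fg X i) (KN i).
move=> /(gen_split (d0 K sK) (d0 N sN) fgK fgN KN)/gen_dsuml.
apply: (gen_quasi_iso I _).1.
apply: (@quasi_iso_bij _ _ _ (chain_comp f (subcx_incl (d0 K sK) fgK))) => i.
  move=> k fk0; apply: val_inj; case: (NK i) => _ + _; apply=> //.
  exact: subm_valP.
move=> y; have [x ->] := fsurj i y.
case: (NK i) => _ _ /(_ x)[n [k [Nn Kk ->]]].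
by exists (to_subm (sK i) Kk); rewrite linearD Nn add0r.
Qed.

(** Such a complex is a quotient of A/J placed in degree a, hence a summand. *)
Lemma gen_cyclic Y (a : int) (x : forall i, Y i) :
  zero_diff Y -> (forall i, killed_by_jacobson (Y i)) ->
  (forall i y, exists c : A, y = c *: x i) -> (forall i, a != i -> x i = 0) ->
  genJ Y.
Proof.
move=> dY JY Yx x0.
pose Q := shift_complex (- a) (stalk (fg_quoJ A)).
have dQ : zero_diff Q.
  by move=> i j e q; rewrite /= /shift_diff; case: odd; rewrite /= ?oppr0.
have fE (i j : int) (e : i + 1 = j) (q : Q i) :
    stalk_out (quoJ_out (x j) (JY j)) (diff Q e q) =
    diff Y e (stalk_out (quoJ_out (x i) (JY i)) q).
  by rewrite dQ dY linear0.
pose f : chain_map Q Y :=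
  @ChainMap A Q Y (fun i => @stalk_out _ _ (quoJ_out (x i) (JY i)) (i - a)) fE.
apply: (@gen_quotient Q Y f) => //.
- by move=> i; apply/stalk_killed/quoJ_killed.
- move=> i y; have [c ->] := Yx i y; have [ai|/eqP ai] := pselect (a = i).
    have ia0 : i - a = 0 by rewrite ai subrr.
    have [q qE] := stalk_out_surj (quoJ_out (x i) (JY i)) (quoJ_pi c) ia0.
    by exists q; rewrite [RHS]qE /= quoJ_out_pi.
  by exists 0; rewrite linear0 x0 ?scaler0.
exact/(@gen_shift (Db A) _ (- a) (quoJ_Db A))/gen_base.
Qed.

(** Induction on the number of homogeneous generators: the submodule that the
    first one generates is a direct summand, and the projections of the others
    generate its complement. *)
Lemma gen_zero_diff X (s : seq {i : int & X i}) :
  zero_diff X -> (forall i, killed_by_jacobson (X i)) ->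
  (forall W : forall i, set (X i), (forall i, submod (W i)) ->
    (forall t, t \in s -> W (tag t) (tagged t)) -> forall i x, W i x) ->
  genJ X.
Proof.
move: {2}(size s) (erefl (size s)) => n.
elim: n X s => [|n IH] X [|[a x] s] //= sn dX JX sX.
  apply/gen_zero/is_zero_Db.
  by apply: (sX (fun i => [set 0])) => // i; apply: submod_set0.
pose xf := dfwith (fun i => 0 : X i) x.
pose U i := cyclic_sub (xf i).
have sU i : submod (U i) by apply: submod_cyclic.
have UK_ex i := complement_ex hA (JX i) (sU i).
pose K i := projT1 (cid (UK_ex i)).
have UK i : complement (U i) (K i) := projT2 (cid (UK_ex i)).
have sK i : submod (K i) by case: (UK i).
have d0 := zero_diff_stable dX.
have fgU i := fg_complement (sU i) (term_fg X i) (UK i).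
have fgK i := fg_complement (sK i) (term_fg X i) (complement_sym (sU i) (UK i)).
have sub_dX W sW (fgW : forall i, fg_module (subm (sW i))) :
    zero_diff (subcx (d0 W sW) fgW).
  by move=> i j e w; apply: val_inj; apply: dX.
have sub_JX W sW (fgW : forall i, fg_module (subm (sW i))) i :
    killed_by_jacobson (subcx (d0 W sW) fgW i).
  by move=> u w Ju; apply: val_inj; apply: JX.
apply/(gen_split (d0 U sU) (d0 K sK) fgU fgK UK)/gen_dsum.
  pose xs i : subcx (d0 U sU) fgU i := to_subm (sU i) (cyclic_sub_gen (xf i)).
  apply: (@gen_cyclic _ a xs) => //.
    move=> i y; have [c yE] := subm_valP y; exists c; exact: val_inj.
  by move=> i ai; apply: val_inj; rewrite /= /xf dfwith_out.
have proj_ex i (y : X i) : exists k : subcx (d0 K sK) fgK i, U i (y - val k).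
  case: (UK i) => _ _ /(_ y)[u [k [Uu Kk ->]]].
  by exists (to_subm (sK i) Kk); rewrite addrK.
pose p i y := projT1 (cid (@proj_ex i y)).
have pP i y : U i (y - val (p i y)) := projT2 (cid (@proj_ex i y)).
apply: (IH _ [seq existT (fun i => subcx (d0 K sK) fgK i) (tag t)
  (p _ (tagged t)) | t <- s]) => // [|W sW Wp].
  by rewrite size_map; case: sn.
pose W' i := sum_sub (U i) [set y | exists2 w, W i w & y = val w].
have sW' i : submod (W' i).
  apply: submod_sum_sub => //; case: (sW i) => W0 WD WZ.
  split=> [|_ _ [y Wy ->] [z Wz ->]|c _ [y Wy ->]].
  - by exists 0; rewrite ?raddf0.
  - by exists (y + z); [apply: WD|rewrite raddfD].
  - by exists (c *: y); [apply: WZ|rewrite linearZ].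
have W'T : forall i y, W' i y.
  apply: sX => // t; rewrite inE => /orP[/eqP->|ts] /=.
    exists x, 0; rewrite addr0; split=> //.
      by exists 1; rewrite scale1r /xf dfwith_in.
    by exists 0 => //; case: (sW a).
  exists (tagged t - val (p _ (tagged t))), (val (p _ (tagged t))).
  rewrite subrK; split=> //; exists (p _ (tagged t)) => //.
  exact: Wp (map_f _ ts).
move=> i k; have [u [_ [Uu [w Ww ->] kE]]] := W'T i (val k).
case: (UK i) => _ UK0 _; suff -> : k = w by [].
apply: val_inj; rewrite kE (UK0 u) ?add0r //.
rewrite -(addrK (val w) u) -kE.
by apply: submodB => //; apply: subm_valP.
Qed.

Lemma homogeneous_generators X : exists s : seq {i : int & X i},
  forall W : forall i, set (X i), (forall i, submod (@W i)) ->
    (forall t, t \in s -> W (tag t) (tagged t)) -> forall i x, W i x.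
Proof.
have [N XN] := term_bounded X.
pose g i := projT1 (cid ((fg_moduleP (X i)).1 (term_fg X i))).
have gP i := projT2 (cid ((fg_moduleP (X i)).1 (term_fg X i))) : forall W,
  submod W -> (forall x, x \in g i -> W x) -> forall v, W v.
pose degrees : seq int := [seq (Posz k - Posz N) | k <- iota 0 (N + N).+1].
exists [seq existT (fun i => X i) i x | i <- degrees, x <- g i] => W sW Ws i x.
have [Ni|iN] := ltnP N `|i|; first by rewrite (XN i Ni x); case: (sW i).
apply: gP => // y yg; apply: (Ws (existT _ i y)).
apply/allpairsPdep; exists i, y; split=> //.
apply/mapP; exists `|(i + Posz N)%R|%N; last by lia.
by rewrite mem_iota; lia.
Qed.

(** In each degree choose a complement of the boundaries and intersect it with
    the cycles: the result is a subcomplex with zero differential that maps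
    isomorphically onto the cohomology. *)
Lemma gen_semisimple X : (forall i, killed_by_jacobson (X i)) -> genJ X.
Proof.
move=> JX.
pose B j : set (X j) := [set y | exists i (e : i + 1 = j) x, y = diff X e x].
pose Z j : set (X j) :=
  [set y | forall k (e : j + 1 = k), diff X e y = 0].
have sB j : submod (@B j).
  split=> [|_ _ [i [e [x ->]]] [i' [e' [x' ->]]]|a _ [i [e [x ->]]]].
  - by exists (j - 1), (subrK 1 j), 0; rewrite linear0.
  - have [y ->] := diff_reindex e' e x'.
    by exists i, e, (x + y); rewrite linearD.
  - by exists i, e, (a *: x); rewrite linearZZ.
have sZ j : submod (@Z j).
  split=> [k e|x y Zx Zy k e|a x Zx k e]; first exact: linear0.
    by rewrite linearD Zx Zy addr0.
  by rewrite linearZZ Zx scaler0.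
have BK_ex i := complement_ex hA (JX i) (sB i).
pose K i := projT1 (cid (BK_ex i)).
have BK i : complement (@B i) (K i) := projT2 (cid (BK_ex i)).
have sK i : submod (K i) by case: (BK i).
pose H i := K i `&` @Z i.
have sH i : submod (H i) by apply: submod_setI.
have fgH i : fg_module (subm (sH i)).
  have [C HC] := complement_ex hA (JX i) (sH i).
  exact: fg_complement (term_fg X i) HC.
have dH (i j : int) (e : i + 1 = j) x : H i x -> H j (diff X e x).
  by move=> [_ ->]; case: (sH j).
have Hq : quasi_iso (subcx_incl dH fgH).
  move=> i j k e e'; split=> [x _ [y xE]|y dy0].
    exists 0; rewrite linear0; apply: val_inj; case: (BK j) => _ BK0 _.
    apply: BK0; first by exists i, e, y.
    by case: (subm_valP x).
  case: (BK j) => _ _ /(_ y)[b [h [[i' [f [z bE]]] Kh yE]]].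
  have Zy : Z j y.
    move=> k' e''; have kk' : k = k' by rewrite -e'.
    by case: k' / kk' e'' => e''; rewrite (eq_irrelevance e'' e').
  have Hh : H j h.
    split=> // k' e''; rewrite -(addKr b h) -yE linearD linearN bE diffK oppr0.
    by rewrite add0r Zy.
  exists (to_subm (sH j) Hh); first by apply: val_inj; exact: Hh.2.
  by have [z' zE] := diff_reindex f e z; exists z'; rewrite -zE -bE addrC.
apply/(gen_quasi_iso _ Hq).
have [s sP] := homogeneous_generators (subcx dH fgH).
apply: (gen_zero_diff _ _ sP).
- by move=> i j e x; apply: val_inj; case: (subm_valP x) => _; apply.
- by move=> i u x Ju; apply: val_inj; apply: JX.
Qed.

(** * The filtration by powers of the radical *)

(** J V, as an intersection: an inclusion J V in W is then tested on the
    products u x only. *)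
Definition rad_sub (V : lmodType A) : set V :=
  [set v | forall W, submod W ->
    (forall u x, jacobson u -> W (u *: x)) -> W v].

Lemma submod_rad_sub (V : lmodType A) : submod (@rad_sub V).
Proof.
split=> [W [] //|x y Rx Ry W sW JW|a x Rx W sW JW]; case: (sW) => _ WD WZ.
  by apply: WD; [apply: Rx|apply: Ry].
by apply: WZ; apply: Rx.
Qed.

Lemma rad_subZ (V : lmodType A) u (x : V) : jacobson u -> rad_sub (u *: x).
Proof. by move=> Ju W _; apply. Qed.

Lemma rad_sub_linear (V W : lmodType A) (f : {linear V -> W}) v :
  rad_sub v -> rad_sub (f v).
Proof.
move=> Rv; have [R0 RD RZ] := submod_rad_sub W.
apply: (Rv [set v | rad_sub (f v)]); last first.
  by move=> u x Ju; rewrite /= linearZZ; apply: rad_subZ.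
split=> [|x y Rx Ry|a x Rx]; rewrite /= ?linear0 //.
  by rewrite linearD; apply: RD.
by rewrite linearZZ; apply: RZ.
Qed.

(** If s generates J and t generates V, the products u x with u in s and x in t
    generate J V: J is a right ideal, so J V is the sum of the J x, x in t. *)
Lemma fg_rad_sub (V : lmodType A) :
  fg_module V -> fg_module (subm (submod_rad_sub V)).
Proof.
move=> /fg_moduleP[t tP]; have [s sJ sP] := jacobson_fg hA.
apply: (@fg_subm _ _ _ _ [seq u *: x | u <- s, x <- t]) => [y|W sW Wst v].
  by case/allpairsP=> -[u x] [/= us _ ->]; apply: rad_subZ (sJ u us).
case: (sW) => W0 WD WZ; apply=> // u x Ju.
suff /(_ x) : forall x, [set x | forall u, jacobson u -> W (u *: x)] x by apply.
apply: tP => [|y yt].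
  split=> [w _|y z Wy Wz w Jw|a y Wy w Jw].
  - by rewrite scaler0.
  - by rewrite scalerDr; apply: WD (Wy w Jw) (Wz w Jw).
  - by rewrite scalerA; apply: Wy (jacobson_mulr a Jw).
move=> w; apply: (sP [set w | W (w *: y)]) => [|w' w's].
  split=> [|a b Wa Wb|a b Wb]; rewrite /= ?scale0r //.
    by rewrite scalerDl; apply: WD.
  by rewrite -scalerA; apply: WZ.
by apply: Wst; apply/allpairsP; exists (w', y).
Qed.

Lemma rad_sub_killed n (V : lmodType A) :
  (forall a (x : V), jacobson_pow n.+1 a -> a *: x = 0) ->
  forall a (v : V), jacobson_pow n a -> rad_sub v -> a *: v = 0.
Proof.
move=> JV a v + Rv; move: a.
apply: (Rv [set v | forall a, jacobson_pow n a -> a *: v = 0]); last first.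
  by move=> u x Ju a Ja; rewrite scalerA JV //; apply: jacobson_powSr.
split=> [a _|x y Rx Ry a Ja|b x Rx a Ja]; first by rewrite scaler0.
  by rewrite scalerDr Rx ?Ry ?addr0.
by rewrite scalerA Rx //; apply: jacobson_pow_mulr.
Qed.

(** The induction on the Loewy length, along the triangle JX -> X -> X/JX. *)
Lemma geni_killed n X :
  (forall i a (x : X i), jacobson_pow n a -> a *: x = 0) ->
  geni (only (quoJ_Db A)) n (X : Db A).
Proof.
elim: n X => [|n IH] X JX.
  by apply: is_zero_Db => i x; rewrite -[x]scale1r; apply: JX.
pose dR (i j : int) (e : i + 1 = j) x := rad_sub_linear (diff X e) (v := x).
have fgR i := fg_rad_sub (term_fg X i).
apply/gen_base/(star_subcx_quotcx (dU := dR) (fgU := fgR)).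
  apply: IH => i a x Ja; apply: val_inj.
  exact: rad_sub_killed (JX i) _ _ Ja (subm_valP x).
apply: gen_semisimple => i u q Ju; rewrite -[q]quotm_piK -linearZZ.
by apply/quotm_pi_eq0; apply: rad_subZ Ju.
Qed.

End Semisimple.

Theorem proposition7p38 (A : pzRingType) (hA : left_artinian A) :
  exists l : nat,
    is_loewy_length A l /\
    (forall X : Db A, geni (only (quoJ_Db A)) l X) /\
    (exists d : nat, is_dim (Db A) d /\ (d <= l - 1)%N).
Proof.
have least (P : nat -> Prop) n : P n -> exists m, is_least P m.
  move=> Pn; have exP : exists n, `[< P n >] by exists n; apply/asboolP.
  by exists (ex_minn exP); split=> [|k Pk]; case: ex_minnP => m /asboolP // _;
    apply; apply/asboolP.
have [n Jn] := jacobson_nilpotent hA.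
have [l [Jl lmin]] := least (fun i => @jacobson_pow A i = [set 0]) _ Jn.
have genl (X : Db A) : geni (only (quoJ_Db A)) l X.
  by apply: geni_killed => // i a x; rewrite Jl => ->; rewrite scale0r.
exists l; split; first by split.
split=> //.
have dimP : exists M : Db A, forall X, geni (only M) (l - 1).+1 X.
  (* For l = 0 every object is zero, hence also in the next layer. *)
  exists (quoJ_Db A) => X; case: l {Jl lmin} genl => [|l] genl.
    exact/gen_zero/genl.
  by rewrite subn1; apply: genl.
have [d dP] :=
  least (fun d => exists M : Db A, forall X, geni (only M) d.+1 X) _ dimP.
by exists d; split=> //; case: dP => _; apply.
Qed.
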